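(* Let $\mathcal{A}$ be a quasi-abelian category and $\Lambda$ a totally ordered, uniquely divisible abelian group. Then $W\mathcal{A}^{\mathrm{pre}}$ is an additive category with kernels and cokernels. It is quasi-abelian if and only if the modular law holds in $\mathcal{A}$.
   Context: In an additive category with kernels and cokernels, put $\mathrm{Coim} f = \mathrm{Coker}(\ker f)$ and $\mathrm{Im} f = \mathrm{Ker}(\mathrm{coker} f)$; $f$ is strict if the canonical morphism $\mathrm{Coim} f \to \mathrm{Im} f$ is an isomorphism. Strict monics (strict subobjects) are exactly the kernels, strict epis exactly the cokernels. A quasi-abelian category is an additive category with kernels and cokernels in which kernels are stable under pushout and cokernels are stable under pullback. For strict subobjects $A, B$ of $X$: $A \cap B$ is the pullback, $A + B$ is the image of $A \oplus B \to X$. The modular law holds in $\mathcal{A}$ if for all strict subobjects $A \hookrightarrow B \hookrightarrow X$ and $C \hookrightarrow X$ in $\mathcal{A}$, the canonical morphism $A + (B \cap C) \hookrightarrow B \cap (A + C)$ is an isomorphism. An ascending $\Lambda$-indexed filtration on $M \in \mathcal{A}$ is a functor $\Lambda \to \mathcal{A}$, $\lambda \mapsto W_{\leq\lambda}M$ ($\Lambda$ viewed as an ordered set) such that: it admits a colimit cone with vertex $M$ for which each $W_{\leq\lambda}M \to M$ is a strict subobject (exhaustiveness); the limit over all $\lambda$ exists and is $0$ (separatedness); and for all $\lambda$ the limit $\lim_{\lambda'>\lambda} W_{\leq\lambda'}M$ exists and equals $W_{\leq\lambda}M$ (right continuity). It is finite if it is isomorphic to a finite flag $0 \hookrightarrow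 W_{\leq\lambda_0}M \hookrightarrow \dots \hookrightarrow W_{\leq\lambda_r}M = M$ with $\lambda_0 < \dots < \lambda_r$ (the breaks), the filtration being constant precisely on the intervals $\lambda_{i-1} \leq \lambda < \lambda_i$. $W\mathcal{A}^{\mathrm{pre}}$ is the full subcategory of the category $\mathrm{Fun}(\Lambda,\mathcal{A})$ of functors $\Lambda \to \mathcal{A}$ consisting of the finite ascending $\Lambda$-indexed filtrations.
   Formalization: The group Λ is assumed nontrivial: for Λ = 0 separatedness makes WA^pre the zero category, which is quasi-abelian, although the modular law fails e.g. in Banach spaces. *)

(* Defs.v *)
From HB Require Import structures.
From mathcomp Require Import all_boot all_order all_algebra.
From mathcomp Require Import boolp.

Set Implicit Arguments.
Unset Strict Implicit.
Unset Printing Implicit Defensive.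

Import Order.TTheory GRing.Theory.

Declare Scope cat_scope.
Delimit Scope cat_scope with cat.

Record category := Category {
  obj :> Type;
  hom : obj -> obj -> Type;
  idm : forall X, hom X X;
  compm : forall X Y Z, hom Y Z -> hom X Y -> hom X Z;
  comp1m : forall X Y (f : hom X Y), compm (idm Y) f = f;
  compm1 : forall X Y (f : hom X Y), compm f (idm X) = f;
  compmA : forall X Y Z T (h : hom Z T) (g : hom Y Z) (f : hom X Y),
    compm h (compm g f) = compm (compm h g) f
}.

Arguments hom {c} X Y.
Arguments idm {c} X.
Arguments compm {c X Y Z} g f.

Notation "g ∘ f" := (compm g f) (at level 40, left associativity) : cat_scope.
Local Open Scope cat_scope.

Record functor (C D : category) := Functor {
  fobj :> C -> D;
  fmap : forall X Y : C, hom X Y -> hom (fobj X) (fobj Y);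
  fmap1 : forall X : C, fmap (idm X) = idm (fobj X);
  fmapM : forall (X Y Z : C) (g : hom Y Z) (f : hom X Y),
    fmap (g ∘ f) = fmap g ∘ fmap f
}.

Arguments fmap {C D} f {X Y} u : rename.

Record nat_trans (C D : category) (F G : functor C D) := NatTrans {
  ntc :> forall X : C, hom (F X) (G X);
  ntP : forall (X Y : C) (u : hom X Y), ntc Y ∘ fmap F u = fmap G u ∘ ntc X
}.

Lemma nat_trans_eq (C D : category) (F G : functor C D) (a b : nat_trans F G) :
  (forall X, a X = b X) -> a = b.
Proof.
case: a b => [a aP] [b bP] /= ab.
have {}ab : a = b by apply: functional_extensionality_dep.
by subst b; rewrite (Prop_irrelevance aP bP).
Qed.

Section FunctorCategory.
Variables C D : category.
Implicit Types F G H : functor C D.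

Lemma nat_id_subproof F (X Y : C) (u : hom X Y) :
  idm (F Y) ∘ fmap F u = fmap F u ∘ idm (F X).
Proof. by rewrite comp1m compm1. Qed.

Definition nat_id F : nat_trans F F := NatTrans (@nat_id_subproof F).

Lemma nat_comp_subproof F G H (b : nat_trans G H) (a : nat_trans F G)
    (X Y : C) (u : hom X Y) :
  b Y ∘ a Y ∘ fmap F u = fmap H u ∘ (b X ∘ a X).
Proof. by rewrite -compmA ntP compmA ntP compmA. Qed.

Definition nat_comp F G H (b : nat_trans G H) (a : nat_trans F G) :
  nat_trans F H := NatTrans (nat_comp_subproof b a).

Lemma nat_comp1m F G (a : nat_trans F G) : nat_comp (nat_id G) a = a.
Proof. by apply: nat_trans_eq => X /=; rewrite comp1m. Qed.

Lemma nat_compm1 F G (a : nat_trans F G) : nat_comp a (nat_id F) = a.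
Proof. by apply: nat_trans_eq => X /=; rewrite compm1. Qed.

Lemma nat_compmA F G H K (c : nat_trans H K) (b : nat_trans G H)
    (a : nat_trans F G) :
  nat_comp c (nat_comp b a) = nat_comp (nat_comp c b) a.
Proof. by apply: nat_trans_eq => X /=; rewrite compmA. Qed.

Definition functor_cat : category :=
  Category nat_comp1m nat_compm1 nat_compmA.

End FunctorCategory.

Section FullSubcategory.
Variables (C : category) (P : C -> Prop).

Definition full_subcat : category := {|
  obj := {X : C | P X};
  hom X Y := hom (sval X) (sval Y);
  idm X := idm (sval X);
  compm X Y Z g f := g ∘ f;
  comp1m X Y f := comp1m f;
  compm1 X Y f := compm1 f;
  compmA X Y Z T h g f := compmA h g f |}.

Definition subcat_incl : functor full_subcat C := {|
  fobj := fun X : full_subcat => sval X;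
  fmap := fun X Y (f : @hom full_subcat X Y) => f;
  fmap1 := fun X => erefl;
  fmapM := fun X Y Z g f => erefl |}.

End FullSubcategory.

Section FunctorComposition.
Variables (C D E : category) (G : functor D E) (F : functor C D).

Lemma fcomp_subproof1 (X : C) : fmap G (fmap F (idm X)) = idm (G (F X)).
Proof. by rewrite !fmap1. Qed.

Lemma fcomp_subproofM (X Y Z : C) (g : hom Y Z) (f : hom X Y) :
  fmap G (fmap F (g ∘ f)) = fmap G (fmap F g) ∘ fmap G (fmap F f).
Proof. by rewrite !fmapM. Qed.

Definition fcomp : functor C E :=
  @Functor C E (fun X => G (F X)) (fun X Y u => fmap G (fmap F u))
    fcomp_subproof1 fcomp_subproofM.

End FunctorComposition.

Definition poset_cat (d : Order.disp_t) (L : porderType d) : category := {|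
  obj := L;
  hom x y := (x <= y)%O;
  idm x := lexx x;
  compm x y z yz xy := le_trans xy yz;
  comp1m x y f := bool_irrelevance _ _;
  compm1 x y f := bool_irrelevance _ _;
  compmA x y z t h g f := bool_irrelevance _ _ |}.

Section Limits.
Variables (J C : category) (D : functor J C).

Definition is_cone (V : C) (p : forall j, hom V (D j)) : Prop :=
  forall (i j : J) (u : hom i j), fmap D u ∘ p i = p j.

Definition is_limit (V : C) (p : forall j, hom V (D j)) : Prop :=
  is_cone p /\
  forall (T : C) (q : forall j, hom T (D j)), is_cone q ->
    exists! h : hom T V, forall j, p j ∘ h = q j.

Definition is_cocone (V : C) (p : forall j, hom (D j) V) : Prop :=
  forall (i j : J) (u : hom i j), p j ∘ fmap D u = p i.

Definition is_colimit (V : C) (p : forall j, hom (D j) V) : Prop :=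
  is_cocone p /\
  forall (T : C) (q : forall j, hom (D j) T), is_cocone q ->
    exists! h : hom V T, forall j, h ∘ p j = q j.

End Limits.

Section CategoricalNotions.
Variable C : category.
Implicit Types X Y Z K Q S : C.

Definition is_iso X Y (f : hom X Y) : Prop :=
  exists g : hom Y X, g ∘ f = idm X /\ f ∘ g = idm Y.

Definition monic X Y (f : hom X Y) : Prop :=
  forall T (u v : hom T X), f ∘ u = f ∘ v -> u = v.

Definition is_zero_obj Z : Prop :=
  forall X, (exists! f : hom X Z, True) /\ (exists! f : hom Z X, True).

(* In an additive category these are exactly the zeros of the hom groups. *)
Definition is_zero_mor X Y (f : hom X Y) : Prop :=
  exists Z (g : hom Z Y) (h : hom X Z), is_zero_obj Z /\ f = g ∘ h.

Definition is_kernel X Y (f : hom X Y) K (k : hom K X) : Prop :=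
  is_zero_mor (f ∘ k) /\
  forall T (t : hom T X), is_zero_mor (f ∘ t) -> exists! h : hom T K, k ∘ h = t.

Definition is_cokernel X Y (f : hom X Y) Q (q : hom Y Q) : Prop :=
  is_zero_mor (q ∘ f) /\
  forall T (t : hom Y T), is_zero_mor (t ∘ f) -> exists! h : hom Q T, h ∘ q = t.

Definition has_kernels : Prop :=
  forall X Y (f : hom X Y), exists K (k : hom K X), is_kernel f k.

Definition has_cokernels : Prop :=
  forall X Y (f : hom X Y), exists Q (q : hom Y Q), is_cokernel f q.

Definition kernel_mor K X (k : hom K X) : Prop :=
  exists Y (f : hom X Y), is_kernel f k.

Definition cokernel_mor Y Q (q : hom Y Q) : Prop :=
  exists X (f : hom X Y), is_cokernel f q.

Definition is_pullback X Y Z (f : hom X Z) (g : hom Y Z)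
    P (p : hom P X) (q : hom P Y) : Prop :=
  f ∘ p = g ∘ q /\
  forall T (u : hom T X) (v : hom T Y), f ∘ u = g ∘ v ->
    exists! h : hom T P, p ∘ h = u /\ q ∘ h = v.

Definition is_pushout X Y Z (f : hom Z X) (g : hom Z Y)
    P (p : hom X P) (q : hom Y P) : Prop :=
  p ∘ f = q ∘ g /\
  forall T (u : hom X T) (v : hom Y T), u ∘ f = v ∘ g ->
    exists! h : hom P T, h ∘ p = u /\ h ∘ q = v.

Definition is_coproduct X Y S (i : hom X S) (j : hom Y S) : Prop :=
  forall T (u : hom X T) (v : hom Y T),
    exists! h : hom S T, h ∘ i = u /\ h ∘ j = v.

Section Preadditive.
Variable add : forall X Y, GRing.Zmodule (hom X Y).

Definition hom_zmod X Y : zmodType := GRing.Zmodule.Pack (add X Y).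

Definition addm X Y (f g : hom X Y) : hom X Y := ((f : hom_zmod X Y) + g)%R.
Definition zerom X Y : hom X Y := (0 : hom_zmod X Y)%R.

Definition bilinear_comp : Prop :=
  (forall X Y Z (g g' : hom Y Z) (f : hom X Y),
     addm g g' ∘ f = addm (g ∘ f) (g' ∘ f)) /\
  (forall X Y Z (g : hom Y Z) (f f' : hom X Y),
     g ∘ addm f f' = addm (g ∘ f) (g ∘ f')).

Definition is_biproduct X Y S (i : hom X S) (j : hom Y S)
    (p : hom S X) (q : hom S Y) : Prop :=
  [/\ p ∘ i = idm X, q ∘ j = idm Y, p ∘ j = zerom Y X, q ∘ i = zerom X Y
    & addm (i ∘ p) (j ∘ q) = idm S].

End Preadditive.

Definition additive_category : Prop :=
  exists add : forall X Y, GRing.Zmodule (hom X Y),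
    [/\ bilinear_comp add,
        exists Z, is_zero_obj Z
      & forall X Y, exists S (i : hom X S) (j : hom Y S)
          (p : hom S X) (q : hom S Y), is_biproduct add i j p q].

Definition quasi_abelian : Prop :=
  [/\ additive_category, has_kernels, has_cokernels,
      forall X Y Z P (f : hom Z X) (g : hom Z Y) (p : hom X P) (q : hom Y P),
        is_pushout f g p q -> kernel_mor f -> kernel_mor q
    & forall X Y Z P (f : hom X Z) (g : hom Y Z) (p : hom P X) (q : hom P Y),
        is_pullback f g p q -> cokernel_mor f -> cokernel_mor q].

(* (Co)kernels are only given up to isomorphism, so "the" canonical morphism
   [m : Coim f -> Im f] is pinned down by [i ∘ m ∘ q = f]. *)
Definition strict X Y (f : hom X Y) : Prop :=
  exists K (k : hom K X) Coim (q : hom X Coim) Q (c : hom Y Q) Im (i : hom Im Y)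
    (m : hom Coim Im),
    [/\ is_kernel f k /\ is_cokernel k q, is_cokernel f c /\ is_kernel c i,
        i ∘ m ∘ q = f & is_iso m].

Definition strict_sub X Y (f : hom X Y) : Prop := monic f /\ strict f.

Definition is_image X Y (f : hom X Y) I (i : hom I Y) : Prop :=
  exists Q (c : hom Y Q), is_cokernel f c /\ is_kernel c i.

(* [i] represents the subobject A ∩ B of X. *)
Definition is_meet X A B (a : hom A X) (b : hom B X) I (i : hom I X) : Prop :=
  exists (p : hom I A) (q : hom I B), is_pullback a b p q /\ i = a ∘ p.

(* [s] represents the subobject A + B of X. *)
Definition is_join X A B (a : hom A X) (b : hom B X) S (s : hom S X) : Prop :=
  exists D (i : hom A D) (j : hom B D) (h : hom D X),
    [/\ is_coproduct i j, h ∘ i = a, h ∘ j = b & is_image h s].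

(* The canonical morphism [m] is the morphism of subobjects of X from
   [t : A + (B ∩ D) -> X] to [u : B ∩ (A + D) -> X]; it is unique because
   [u] is monic. *)
Definition modular_law : Prop :=
  forall X A B D (a : hom A B) (b : hom B X) (d : hom D X),
    strict_sub a -> strict_sub b -> strict_sub d ->
  forall BD AD S U
    (bd : hom BD X) (t : hom S X) (ad : hom AD X) (u : hom U X),
    is_meet b d bd -> is_join (b ∘ a) bd t ->
    is_join (b ∘ a) d ad -> is_meet b ad u ->
  exists m : hom S U, u ∘ m = t /\ is_iso m.

End CategoricalNotions.

Section Filtrations.
Variables (A : category) (d : Order.disp_t) (L : porderType d).
Implicit Types (F : functor (poset_cat L) A) (l m : L).

Definition exhaustive F : Prop :=
  exists (M : A) (c : forall l, hom (F l) M),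
    is_colimit (D := F) c /\ forall l, strict_sub (c l).

Definition separated F : Prop :=
  exists (Z : A) (p : forall l, hom Z (F l)),
    is_limit (D := F) p /\ is_zero_obj Z.

Definition above l : category :=
  full_subcat (C := poset_cat L) (fun m => (l < m)%O).

Definition restr_above F l : functor (above l) A := fcomp F (subcat_incl _).

Definition trans_above F l (m : above l) : hom (F l) (restr_above F l m) :=
  fmap F (X := l) (Y := sval m) (ltW (svalP m)).

Definition right_continuous F : Prop :=
  forall l, is_limit (D := restr_above F l) (@trans_above F l).

Definition is_filtration F : Prop :=
  [/\ exhaustive F, separated F & right_continuous F].

(* The breaks are the entries of [bs]. The list may be empty, which is the
   case of the filtration on the zero object. By the second clause, F is also
   constant from the last break on, with value the colimit of F. *)
Definition finite_filtration F : Prop :=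
  exists bs : seq L,
    [/\ sorted <%O bs,
        forall l, (forall b, b \in bs -> (l < b)%O) -> is_zero_obj (F l)
      & forall l m (lm : (l <= m)%O),
          is_iso (fmap F (X := l) (Y := m) lm) <->
          (forall b, b \in bs -> ~ (l < b <= m)%O)].

Definition Wpre : category :=
  full_subcat (C := functor_cat (poset_cat L) A)
    (fun F => is_filtration F /\ finite_filtration F).

End Filtrations.

(* Main.v *)
From HB Require Import structures.
From mathcomp Require Import all_boot all_order all_algebra.
From mathcomp Require Import boolp.
Require Import Defs.

(** The filtrations in question are the functors given by a monotone family of
    strict subobjects of an object [M] that jumps finitely often. Kernels in
    [Wpre] are computed degreewise; a cokernel is the cokernel [C] of the map of
    underlying objects, filtered by the strict images of the [W_l N -> C]. So
    [q : N -> Q] is a cokernel iff it is one on underlying objects and each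
    [W_l Q] is the strict image of [W_l N], and [k : K -> N] is a kernel iff it is
    one on underlying objects and [W_l K] is the intersection of [K] and [W_l N].
    A pullback of a cokernel (pushout of a kernel) along [f], [g] is the kernel
    (cokernel) of [(f, -g)] on a biproduct [S]; the conditions on the filtrations
    follow from the modular law applied in [S] with [W_l S] in the role of the
    third subobject. Conversely, given [A <= B <= X] and [D <= X], give [X] the
    two-step filtration [D <= X] and pull the cokernel [X -> X/A] back along
    [B/A -> X/A], with the induced filtrations: stability says that the strict
    image of [B ∩ D] is all of [B/A ∩ (A + D)/A], which is the modular law. *)

Set Implicit Arguments.
Unset Strict Implicit.
Unset Printing Implicit Defensive.

Import Order.TTheory GRing.Theory.
Local Open Scope cat_scope.

(** Hom sets are bare types, while [GRing.Zmodule] also contains equality and choice structures;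
    these are supplied classically. *)
Definition zmodule_of_laws (T : Type) (add : T -> T -> T) (opp : T -> T) (zero : T)
    (addA : associative add) (addC : commutative add) (add0 : left_id zero add)
    (addN : left_inverse zero opp add) : GRing.Zmodule T :=
  let cT : choiceType := HB.pack T (gen_eqMixin T) (gen_choiceMixin T) in
  let mT := GRing.isZmodule.Build cT addA addC add0 addN in
  let zT : zmodType := HB.pack T cT mT in
  GRing.Zmodule.class zT.

(** * Monomorphisms and isomorphisms in a category *)

Section Category.
Variable C : category.

Definition epic (X Y : C) (f : hom X Y) : Prop :=
  forall T (u v : hom Y T), u ∘ f = v ∘ f -> u = v.

Lemma iso_monic (X Y : C) (f : hom X Y) : is_iso f -> monic f.
Proof. by case=> g [gf _] T u v /(congr1 (compm g)); rewrite !compmA gf !comp1m. Qed.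

Lemma iso_epic (X Y : C) (f : hom X Y) : is_iso f -> epic f.
Proof.
by case=> g [_ fg] T u v /(congr1 (compm^~ g)); rewrite -!compmA fg !compm1.
Qed.

Lemma monic_section (X Y : C) (f : hom X Y) (g : hom Y X) :
  monic f -> f ∘ g = idm Y -> is_iso f.
Proof.
by move=> mf fg; exists g; split=> //; apply: mf; rewrite compmA fg comp1m compm1.
Qed.

Lemma monic_cancel (X Y Z : C) (f : hom X Y) (g : hom Y Z) :
  monic (g ∘ f) -> monic f.
Proof. by move=> m T u v e; apply: m; rewrite -!compmA e. Qed.

Lemma monic_comp (X Y Z : C) (f : hom X Y) (g : hom Y Z) :
  monic f -> monic g -> monic (g ∘ f).
Proof. by move=> mf mg T u v; rewrite -!compmA => /mg/mf. Qed.

(** A monic with a right inverse is invertible, here [g] with [f ∘ h]. This propagates isomorphisms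
    along the chain W_l -> W_m -> V of a filtration. *)
Lemma iso_cancel_monic (X Y Z : C) (f : hom X Y) (g : hom Y Z) :
  monic g -> is_iso (g ∘ f) -> is_iso g /\ is_iso f.
Proof.
move=> mg [h [hgf gfh]].
have gi : is_iso g by apply: (monic_section (g := f ∘ h)); rewrite // compmA.
split=> //; exists (h ∘ g); split; first by rewrite -compmA.
by apply: mg; rewrite !compmA gfh comp1m compm1.
Qed.

Lemma iso_comp (X Y Z : C) (f : hom X Y) (g : hom Y Z) :
  is_iso f -> is_iso g -> is_iso (g ∘ f).
Proof.
move=> [f' [f1 f2]] [g' [g1 g2]]; exists (f' ∘ g'); split.
  by rewrite -compmA (compmA g') g1 comp1m.
by rewrite -compmA (compmA f) f2 comp1m.
Qed.

Lemma iso_idm (X : C) : is_iso (idm X).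
Proof. by exists (idm X); rewrite comp1m. Qed.

End Category.

(** * Additive categories *)

Module Additive.
Section AdditiveCategory.
Variables (C : category) (add : forall X Y : C, GRing.Zmodule (hom X Y)).
Hypothesis bil : bilinear_comp add.

Local Notation "f + g" := (addm add f g) : cat_scope.
Local Notation "0" := (zerom add _ _) : cat_scope.

Definition oppm (X Y : C) (f : hom X Y) : hom X Y := (- (f : hom_zmod add X Y))%R.
Local Notation "- f" := (oppm f) : cat_scope.

Section Hom.
Variables X Y : C.
Implicit Types f g : hom X Y.
Lemma addmA f g h : f + (g + h) = f + g + h.
Proof. exact: (@addrA (hom_zmod add X Y)). Qed.
Lemma addmC f g : f + g = g + f.
Proof. exact: (@addrC (hom_zmod add X Y)). Qed.
Lemma add0m f : 0 + f = f.
Proof. exact: (@add0r (hom_zmod add X Y)). Qed.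
Lemma addm0 f : f + 0 = f.
Proof. exact: (@addr0 (hom_zmod add X Y)). Qed.
Lemma addmN f : f + - f = 0.
Proof. exact: (@addrN (hom_zmod add X Y)). Qed.
Lemma oppmK f : - - f = f.
Proof. exact: (@opprK (hom_zmod add X Y)). Qed.
Lemma subm0_eq f g : f + - g = 0 -> f = g.
Proof. exact: (@subr0_eq (hom_zmod add X Y)). Qed.
Lemma oppm0 : - (0 : hom X Y) = 0.
Proof. exact: (@oppr0 (hom_zmod add X Y)). Qed.
Lemma addm0_eq f g : f + g = 0 -> g = - f.
Proof. by move=> e; apply: subm0_eq; rewrite oppmK addmC. Qed.
End Hom.

Lemma compDm (X Y Z : C) (g g' : hom Y Z) (f : hom X Y) :
  (g + g') ∘ f = g ∘ f + g' ∘ f.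
Proof. by case: bil => + _; apply. Qed.

Lemma compmD (X Y Z : C) (g : hom Y Z) (f f' : hom X Y) :
  g ∘ (f + f') = g ∘ f + g ∘ f'.
Proof. by case: bil => _; apply. Qed.

Lemma addm_idem0 (X Y : C) (f : hom X Y) : f + f = f -> f = 0.
Proof.
by move=> /(congr1 (fun g => g + - f)); rewrite -addmA addmN addm0.
Qed.

Lemma comp0m (X Y Z : C) (f : hom X Y) : (0 : hom Y Z) ∘ f = 0.
Proof. by apply: addm_idem0; rewrite -compDm addm0. Qed.

Lemma compm0 (X Y Z : C) (g : hom Y Z) : g ∘ (0 : hom X Y) = 0.
Proof. by apply: addm_idem0; rewrite -compmD addm0. Qed.

Lemma compNm (X Y Z : C) (g : hom Y Z) (f : hom X Y) : - g ∘ f = - (g ∘ f).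
Proof. by apply: addm0_eq; rewrite -compDm addmN comp0m. Qed.

Lemma compmN (X Y Z : C) (g : hom Y Z) (f : hom X Y) : g ∘ - f = - (g ∘ f).
Proof. by apply: addm0_eq; rewrite -compmD addmN compm0. Qed.

(** * Zero morphisms, kernels and cokernels *)

Lemma zero_objP (Z : C) : is_zero_obj Z <-> idm Z = 0.
Proof.
split=> [/(_ Z) [[u [_ uU]] _]|Z0 X]; first by rewrite -(uU (idm Z)) // (uU 0).
split; exists 0; split=> // u _.
  by rewrite -[u]comp1m Z0 comp0m.
by rewrite -[u]compm1 Z0 compm0.
Qed.

Hypothesis zero_ex : exists Z : C, is_zero_obj Z.

Lemma zero_morP (X Y : C) (f : hom X Y) : is_zero_mor f <-> f = 0.
Proof.
split=> [[Z [g [h [/zero_objP Z0 ->]]]]|->].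
  by rewrite -[g]compm1 Z0 compm0 comp0m.
by have [Z Z0] := zero_ex; exists Z, 0, 0; rewrite comp0m.
Qed.

(** Working form of the universal property: zero morphisms become zeros of the hom groups, and
    uniqueness of the lift becomes monicity. *)
Lemma kernelP (X Y K : C) (f : hom X Y) (k : hom K X) :
  is_kernel f k <->
  [/\ f ∘ k = 0, monic k & forall T (t : hom T X), f ∘ t = 0 -> exists h, k ∘ h = t].
Proof.
split=> [[/zero_morP fk kU]|[fk mk kE]].
  split=> // [T u v e|T t /zero_morP/kU [h [? _]]]; last by exists h.
  have [|h [_ hU]] := kU T (k ∘ u).
    by apply/zero_morP; rewrite compmA fk comp0m.
  by rewrite -(hU u) // (hU v).
split; first exact/zero_morP.
move=> T t /zero_morP /kE [h <-]; exists h; split=> // h' e.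
by apply: mk.
Qed.

Lemma cokernelP (X Y Q : C) (f : hom X Y) (q : hom Y Q) :
  is_cokernel f q <->
  [/\ q ∘ f = 0, epic q & forall T (t : hom Y T), t ∘ f = 0 -> exists h, h ∘ q = t].
Proof.
split=> [[/zero_morP fk kU]|[fk mk kE]].
  split=> // [T u v e|T t /zero_morP/kU [h [? _]]]; last by exists h.
  have [|h [_ hU]] := kU T (u ∘ q).
    by apply/zero_morP; rewrite -compmA fk compm0.
  by rewrite -(hU u) // (hU v).
split; first exact/zero_morP.
move=> T t /zero_morP /kE [h <-]; exists h; split=> // h' e.
by apply: mk.
Qed.

Lemma kernel_mor_monic (X K : C) (k : hom K X) : kernel_mor k -> monic k.
Proof. by case=> Y [f /kernelP[]]. Qed.

Lemma cokernel_mor_epic (X Q : C) (q : hom X Q) : cokernel_mor q -> epic q.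
Proof. by case=> Y [f /cokernelP[]]. Qed.

(** If [k] is the kernel of [f], then [f] factors through the cokernel [q], so whatever [q] kills is
    killed by [f]. *)
Lemma kernel_of_cokernel (X K Q : C) (k : hom K X) (q : hom X Q) :
  kernel_mor k -> is_cokernel k q -> is_kernel q k.
Proof.
case=> Y [f /kernelP[fk mk kE]] /cokernelP[qk eq qE]; apply/kernelP; split=> //.
by move=> T t qt; apply: kE; have [h <-] := qE _ _ fk; rewrite -compmA qt compm0.
Qed.

Lemma cokernel_of_kernel (X K Q : C) (k : hom K X) (q : hom X Q) :
  cokernel_mor q -> is_kernel q k -> is_cokernel k q.
Proof.
case=> Y [f /cokernelP[fk mk kE]] /kernelP[qk eq qE]; apply/cokernelP; split=> //.
by move=> T t qt; apply: kE; have [h <-] := qE _ _ fk; rewrite compmA qt comp0m.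
Qed.

Lemma monic0 (X Y : C) (f : hom X Y) :
  monic f <-> forall T (t : hom T X), f ∘ t = 0 -> t = 0.
Proof.
split=> [mf T t|f0 T u v e]; first by rewrite -(compm0 _ f) => /mf.
by apply: subm0_eq; apply: f0; rewrite compmD compmN e addmN.
Qed.

Lemma iso_kernel_mor (X Y : C) (f : hom X Y) : is_iso f -> kernel_mor f.
Proof.
move=> fi; exists Y, 0; apply/kernelP; split=> [||T t _]; first exact: comp0m.
  exact: iso_monic.
by case: fi => g [_ fg]; exists (g ∘ t); rewrite compmA fg comp1m.
Qed.

Lemma kernel_comp_iso (X Y K K' : C) (f : hom X Y) (k : hom K X) (u : hom K' K) :
  is_kernel f k -> is_iso u -> is_kernel f (k ∘ u).
Proof.
move=> /kernelP[fk mk kE] ui; apply/kernelP; split.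
- by rewrite compmA fk comp0m.
- by apply: monic_comp => //; apply: iso_monic.
move=> T t /kE[h <-]; case: ui => v [_ uv].
by exists (v ∘ h); rewrite -compmA (compmA u) uv comp1m.
Qed.

Lemma cokernel_comp_iso (X Y Q Q' : C) (f : hom X Y) (q : hom Y Q) (u : hom Q Q') :
  is_cokernel f q -> is_iso u -> is_cokernel f (u ∘ q).
Proof.
move=> /cokernelP[qf eq qE] ui; apply/cokernelP; split.
- by rewrite -compmA qf compm0.
- by move=> T x y; rewrite !compmA => /eq; apply: iso_epic.
move=> T t /qE[h <-]; case: ui => v [vu _].
by exists (h ∘ v); rewrite -compmA (compmA v) vu comp1m.
Qed.

Lemma kernel_iso (X Y K K' : C) (f : hom X Y) (k : hom K X) (k' : hom K' X) :
  is_kernel f k -> is_kernel f k' -> exists2 u : hom K' K, is_iso u & k ∘ u = k'.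
Proof.
move=> /kernelP[fk mk kE] /kernelP[fk' mk' kE'].
have [u ku] := kE _ _ fk'; have [v kv] := kE' _ _ fk.
exists u => //; exists v; split; [apply: mk'|apply: mk].
  by rewrite compmA kv compm1.
by rewrite compmA ku compm1.
Qed.

Lemma cokernel_iso (X Y Q Q' : C) (f : hom X Y) (q : hom Y Q) (q' : hom Y Q') :
  is_cokernel f q -> is_cokernel f q' -> exists2 u : hom Q Q', is_iso u & u ∘ q = q'.
Proof.
move=> /cokernelP[fk mk kE] /cokernelP[fk' mk' kE'].
have [u ku] := kE _ _ fk'; have [v kv] := kE' _ _ fk.
exists u => //; exists v; split; [apply: mk|apply: mk'].
  by rewrite -compmA ku kv comp1m.
by rewrite -compmA kv ku comp1m.
Qed.

(** * Biproducts; pullbacks as kernels and pushouts as cokernels *)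

Section Biproduct.
Variables (X Y S : C) (i : hom X S) (j : hom Y S) (p : hom S X) (q : hom S Y).
Hypothesis bp : is_biproduct add i j p q.

Lemma biproduct_hom_in (T : C) (t : hom T S) : t = i ∘ (p ∘ t) + j ∘ (q ∘ t).
Proof. by case: bp => _ _ _ _ e; rewrite -[LHS]comp1m -e compDm -!compmA. Qed.

Lemma biproduct_hom_out (T : C) (t : hom S T) : t = t ∘ i ∘ p + t ∘ j ∘ q.
Proof. by case: bp => _ _ _ _ e; rewrite -[LHS]compm1 -e compmD !compmA. Qed.

Lemma biproduct_coproduct : is_coproduct i j.
Proof.
have [pi qj pj qi _] := bp.
move=> T u v; exists (u ∘ p + v ∘ q); split.
  by rewrite !compDm -!compmA pi qj pj qi !compm0 !compm1 addm0 add0m.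
by move=> h [<- <-]; rewrite [RHS]biproduct_hom_out.
Qed.

Lemma biproduct_inl_kernel : is_kernel q i.
Proof.
have [pi qj pj qi _] := bp; apply/kernelP; split=> //.
  by apply: (monic_cancel (g := p)); rewrite pi; apply/iso_monic/iso_idm.
by move=> T t qt; exists (p ∘ t); rewrite [RHS]biproduct_hom_in qt compm0 addm0.
Qed.

Lemma pullback_kernel (Z P : C) (f : hom X Z) (g : hom Y Z) (u : hom P X) (v : hom P Y) :
  is_pullback f g u v -> is_kernel (f ∘ p + - (g ∘ q)) (i ∘ u + j ∘ v).
Proof.
have [pi qj pj qi _] := bp.
have pe : p ∘ (i ∘ u + j ∘ v) = u.
  by rewrite compmD !compmA pi pj comp1m comp0m addm0.
have qe : q ∘ (i ∘ u + j ∘ v) = v.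
  by rewrite compmD !compmA qi qj comp1m comp0m add0m.
move=> [fu uU]; apply/kernelP; split.
- by rewrite compDm compNm -!compmA pe qe fu addmN.
- move=> T x y e; have [|h [_ hU]] := uU T (u ∘ x) (v ∘ x); first by rewrite !compmA fu.
  rewrite -(hU x) // (hU y) //.
  have := congr1 (compm p) e; have := congr1 (compm q) e.
  by rewrite !compmA pe qe => -> ->.
move=> T t; rewrite compDm compNm -!compmA => /subm0_eq/uU [h [[hu hv] _]].
by exists h; rewrite [RHS]biproduct_hom_in -hu -hv compDm !compmA.
Qed.

Lemma kernel_pullback (Z P : C) (f : hom X Z) (g : hom Y Z) (k : hom P S) :
  is_kernel (f ∘ p + - (g ∘ q)) k -> is_pullback f g (p ∘ k) (q ∘ k).
Proof.
have [pi qj pj qi _] := bp.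
move=> /kernelP[fk mk kE]; split.
  by apply: subm0_eq; rewrite !compmA -compNm -compDm.
move=> T u v e.
have pe : p ∘ (i ∘ u + j ∘ v) = u.
  by rewrite compmD !compmA pi pj comp1m comp0m addm0.
have qe : q ∘ (i ∘ u + j ∘ v) = v.
  by rewrite compmD !compmA qi qj comp1m comp0m add0m.
have [|h kh] := kE T (i ∘ u + j ∘ v).
  by rewrite compDm compNm -!compmA pe qe e addmN.
exists h; split=> [|h' []]; rewrite -!compmA ?kh // => h1 h2.
by apply: mk; rewrite kh -h1 -h2 -biproduct_hom_in.
Qed.

Lemma pushout_cokernel (Z P : C) (f : hom Z X) (g : hom Z Y) (u : hom X P) (v : hom Y P) :
  is_pushout f g u v -> is_cokernel (i ∘ f + - (j ∘ g)) (u ∘ p + v ∘ q).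
Proof.
have [pi qj pj qi _] := bp.
have ie : (u ∘ p + v ∘ q) ∘ i = u.
  by rewrite compDm -!compmA pi qi compm1 compm0 addm0.
have je : (u ∘ p + v ∘ q) ∘ j = v.
  by rewrite compDm -!compmA qj pj compm1 compm0 add0m.
move=> [fu uU]; apply/cokernelP; split.
- by rewrite compmD compmN !compmA ie je fu addmN.
- move=> T x y e; have [|h [_ hU]] := uU T (x ∘ u) (x ∘ v); first by rewrite -!compmA fu.
  rewrite -(hU x) // (hU y) //.
  have := congr1 (compm^~ i) e; have := congr1 (compm^~ j) e.
  by rewrite -!compmA ie je => -> ->.
move=> T t; rewrite compmD compmN !compmA => /subm0_eq/uU [h [[hu hv] _]].
by exists h; rewrite [RHS]biproduct_hom_out -hu -hv compmD !compmA.
Qed.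

Lemma cokernel_pushout (Z P : C) (f : hom Z X) (g : hom Z Y) (k : hom S P) :
  is_cokernel (i ∘ f + - (j ∘ g)) k -> is_pushout f g (k ∘ i) (k ∘ j).
Proof.
have [pi qj pj qi _] := bp.
move=> /cokernelP[fk mk kE]; split.
  by apply: subm0_eq; rewrite -!compmA -compmN -compmD.
move=> T u v e.
have ie : (u ∘ p + v ∘ q) ∘ i = u.
  by rewrite compDm -!compmA pi qi compm1 compm0 addm0.
have je : (u ∘ p + v ∘ q) ∘ j = v.
  by rewrite compDm -!compmA qj pj compm1 compm0 add0m.
have [|h kh] := kE T (u ∘ p + v ∘ q).
  by rewrite compmD compmN !compmA ie je e addmN.
exists h; split=> [|h' []]; rewrite !compmA ?kh // => h1 h2.
by apply: mk; rewrite kh -h1 -h2 -biproduct_hom_out.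
Qed.

End Biproduct.

(** * Pullbacks, pushouts and strict subobjects *)

Hypothesis bip_ex : forall X Y : C, exists S (i : hom X S) (j : hom Y S)
  (p : hom S X) (q : hom S Y), is_biproduct add i j p q.
Hypothesis ker_ex : has_kernels C.
Hypothesis coker_ex : has_cokernels C.

Lemma pullback_ex (X Y Z : C) (f : hom X Z) (g : hom Y Z) :
  exists P (u : hom P X) (v : hom P Y), is_pullback f g u v.
Proof.
have [S [i [j [p [q bp]]]]] := bip_ex X Y.
have [P [k kk]] := ker_ex (f ∘ p + - (g ∘ q)).
by exists P, (p ∘ k), (q ∘ k); apply: kernel_pullback bp _ _ _ _ _ kk.
Qed.

Lemma pushout_ex (X Y Z : C) (f : hom Z X) (g : hom Z Y) :
  exists P (u : hom X P) (v : hom Y P), is_pushout f g u v.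
Proof.
have [S [i [j [p [q bp]]]]] := bip_ex X Y.
have [P [k kk]] := coker_ex (i ∘ f + - (j ∘ g)).
by exists P, (k ∘ i), (k ∘ j); apply: cokernel_pushout bp _ _ _ _ _ kk.
Qed.

(** A monic has zero kernel, so its coimage map is an isomorphism and strictness makes it an image
    inclusion up to isomorphism. Conversely a kernel is the kernel of its cokernel, hence its own
    image, and its coimage is the identity. *)
Lemma strict_subP (X Y : C) (f : hom X Y) : strict_sub f <-> kernel_mor f.
Proof.
split=> [[mf]|kf].
  move=> [K [k [Co [q [Q [c [Im [i [m [[/kernelP[fk _ _] cq] [_ ki] e mi]]]]]]]]]].
  have k0 : k = 0 by move/monic0: mf => /(_ _ _ fk).
  have qi : is_iso q.
    move/cokernelP: cq => [_ eq qE].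
    have [|h hq] := qE _ (idm X); first by rewrite k0 compm0.
    by exists h; split=> //; apply: eq; rewrite -compmA hq compm1 comp1m.
  exists Q, c; rewrite -e -compmA; apply: kernel_comp_iso => //.
  exact: iso_comp.
have mf := kernel_mor_monic kf; split=> //.
have [K [k kk]] := ker_ex f; have [Q [c cf]] := coker_ex f.
exists K, k, X, (idm X), Q, c, X, f, (idm X).
have k0 : k = 0 by move/monic0: mf; apply; case/kernelP: kk.
split; rewrite ?compm1 //; last exact: iso_idm.
  split=> //; apply/cokernelP; split; first by rewrite k0 compm0.
    exact/iso_epic/iso_idm.
  by move=> T t _; exists t; rewrite compm1.
by split=> //; apply: kernel_of_cokernel.
Qed.

(* The sum of the kernels of u and v is the kernel of the sum of u and v. *)
Lemma kernel_mor_sum (X Y S X' Y' S' : C) (i : hom X S) (j : hom Y S) (p : hom S X)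
    (q : hom S Y) (i' : hom X' S') (j' : hom Y' S') (p' : hom S' X') (q' : hom S' Y')
    (f : hom X X') (g : hom Y Y') :
  is_biproduct add i j p q -> is_biproduct add i' j' p' q' ->
  kernel_mor f -> kernel_mor g -> kernel_mor (i' ∘ f ∘ p + j' ∘ g ∘ q).
Proof.
move=> bp bp' [U [u /kernelP[uf mf fE]]] [V [v /kernelP[vg mg gE]]].
have [T [a [b [c [d bT]]]]] := bip_ex U V.
have [pi qj pj qi _] := bp; have [pi' qj' pj' qi' _] := bp'.
have [ca db cb da _] := bT.
have pe : p' ∘ (i' ∘ f ∘ p + j' ∘ g ∘ q) = f ∘ p.
  by rewrite compmD !compmA pi' pj' !comp0m comp1m addm0.
have qe : q' ∘ (i' ∘ f ∘ p + j' ∘ g ∘ q) = g ∘ q.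
  by rewrite compmD !compmA qi' qj' !comp0m comp1m add0m.
set h := _ + _ in pe qe *.
exists T, (a ∘ u ∘ p' + b ∘ v ∘ q'); apply/kernelP; split.
- rewrite compDm -!compmA pe qe (compmA u) uf (compmA v) vg !comp0m !compm0.
  exact: addm0.
- move=> W x y e; rewrite [x](biproduct_hom_in bp) [y](biproduct_hom_in bp).
  have -> : p ∘ x = p ∘ y by apply: mf; rewrite !compmA -pe -!compmA e.
  by have -> : q ∘ x = q ∘ y by apply: mg; rewrite !compmA -qe -!compmA e.
move=> W t e.
have [|hp hf] := fE _ (p' ∘ t).
  have := congr1 (compm c) e.
  by rewrite compm0 compDm compmD !compmA ca cb comp1m !comp0m addm0.
have [|hq hg] := gE _ (q' ∘ t).
  have := congr1 (compm d) e.
  by rewrite compm0 compDm compmD !compmA da db comp1m !comp0m add0m.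
exists (i ∘ hp + j ∘ hq).
have pe' : p ∘ (i ∘ hp + j ∘ hq) = hp.
  by rewrite compmD !compmA pi pj comp1m comp0m addm0.
have qe' : q ∘ (i ∘ hp + j ∘ hq) = hq.
  by rewrite compmD !compmA qi qj comp1m comp0m add0m.
by rewrite /h compDm -!compmA pe' qe' hf hg -(biproduct_hom_in bp').
Qed.

(** * Consequences of the stability of kernels under pushout *)

Hypothesis pushout_stable :
  forall (X Y Z P : C) (f : hom Z X) (g : hom Z Y) (p : hom X P) (q : hom Y P),
    is_pushout f g p q -> kernel_mor f -> kernel_mor q.

(** A pushout square along a kernel is also a pullback. If [f] is the kernel of [c], the pair of [c]
    and zero induces [d] on the pushout; it shows that [c] kills [x], so [x] lifts along [f]. The
    other component agrees because [q] is monic. *)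
Lemma pushout_kernel_lift (X Y Z P T : C) (f : hom Z X) (g : hom Z Y) (p : hom X P)
    (q : hom Y P) (x : hom T X) (y : hom T Y) :
  is_pushout f g p q -> kernel_mor f -> p ∘ x = q ∘ y ->
  exists2 z, f ∘ z = x & g ∘ z = y.
Proof.
move=> po kf e; have mq := kernel_mor_monic (pushout_stable po kf).
case: (kf) => W [c /kernelP[cf mf fE]].
have [pfqg /(_ W c 0)[|d [[dp dq] _]]] := po; first by rewrite cf comp0m.
have [|z fz] := fE _ x; first by rewrite -dp -compmA e compmA dq comp0m.
by exists z => //; apply: mq; rewrite compmA -pfqg -compmA fz.
Qed.

(** Push [g ∘ f] out along [f]. Since the square is also a pullback, [f] is the kernel of the
    difference of [p ∘ g] and [q]. *)
Lemma kernel_mor_cancel (X Y Z : C) (f : hom X Y) (g : hom Y Z) :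
  kernel_mor (g ∘ f) -> kernel_mor f.
Proof.
move=> kgf; have [P [p [q po]]] := pushout_ex (g ∘ f) f.
exists P, (p ∘ g + - q); apply/kernelP; split.
- by rewrite compDm compNm -compmA; case: po => -> _; rewrite addmN.
- exact: monic_cancel (kernel_mor_monic kgf).
move=> T t; rewrite compDm compNm -compmA => /subm0_eq e.
by have [z _ <-] := pushout_kernel_lift po kgf e; exists z.
Qed.

(** Push [g] out along the cokernel [c] of [f]; then [g ∘ f] is the kernel of [p]. An arrow killed
    by [p] is [g ∘ y] with [c ∘ y] zero, and [y] then lifts along [f]. *)
Lemma kernel_mor_comp (X Y Z : C) (f : hom X Y) (g : hom Y Z) :
  kernel_mor f -> kernel_mor g -> kernel_mor (g ∘ f).
Proof.
move=> kf kg; have [Q [c cf]] := coker_ex f; have [P [p [q po]]] := pushout_ex g c.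
have /kernelP[cf0 mf fE] := kernel_of_cokernel kf cf.
exists P, p; apply/kernelP; split.
- by rewrite compmA; case: po => -> _; rewrite -compmA cf0 compm0.
- by apply: monic_comp => //; apply: kernel_mor_monic.
move=> T t pt; have [|y gy cy] := pushout_kernel_lift (y := 0) po kg (x := t).
  by rewrite compm0.
by have [x fx] := fE _ _ cy; exists x; rewrite -compmA fx.
Qed.

(* The modular law with [B = ker beta]: the premises on [w] say that it factors
   through [B ∩ (A + D)], the conclusion that it factors through [A + (B ∩ D)]. *)
Definition modular_kernels : Prop :=
  forall (X A D Y W : C) (a : hom A X) (d : hom D X) (beta : hom X Y) (w : hom W X),
    kernel_mor a -> kernel_mor d -> beta ∘ a = 0 -> beta ∘ w = 0 ->
    (forall T (s : hom X T), s ∘ a = 0 -> s ∘ d = 0 -> s ∘ w = 0) ->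
  forall T (t : hom X T), t ∘ a = 0 ->
    (forall V (v : hom V D), beta ∘ d ∘ v = 0 -> t ∘ d ∘ v = 0) -> t ∘ w = 0.

Lemma joinP (X A B S : C) (a : hom A X) (b : hom B X) (s : hom S X) :
  is_join a b s ->
  [/\ kernel_mor s, exists u, s ∘ u = a, exists v, s ∘ v = b
    & forall T (t : hom X T), t ∘ a = 0 -> t ∘ b = 0 -> t ∘ s = 0].
Proof.
move=> [D [i [j [h [co <- <- [Q [c [/cokernelP[ch _ cE] ks]]]]]]]].
move/kernelP: (ks) => [cs ms sE]; have [x sx] := sE _ _ ch; split.
- by exists Q, c.
- by exists (x ∘ i); rewrite compmA sx.
- by exists (x ∘ j); rewrite compmA sx.
(* [t] kills [h] by uniqueness on the coproduct, so it factors through the cokernel [c], which kills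
   the image [s]. *)
move=> T t ti tj; have [|y <-] := cE _ t; last by rewrite -compmA cs compm0.
have [g [_ gU]] := co _ (t ∘ h ∘ i) (t ∘ h ∘ j).
rewrite -(gU (t ∘ h)) // (gU 0) //.
by rewrite -!compmA ti tj !comp0m.
Qed.

Lemma join_ex (X A B : C) (a : hom A X) (b : hom B X) : exists S (s : hom S X), is_join a b s.
Proof.
have [D [i [j [p [q bp]]]]] := bip_ex A B.
have [h [[hi hj] _]] := biproduct_coproduct bp a b.
have [Q [c cc]] := coker_ex h; have [S [s ss]] := ker_ex c.
exists S, s, D, i, j, h; split=> //; first exact: biproduct_coproduct bp.
by exists Q, c.
Qed.

(** If [b] is the kernel of [f], then [p] is the kernel of [f ∘ a]; composed with the kernel [a] it
    stays a kernel. *)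
Lemma meetP (X A B I : C) (a : hom A X) (b : hom B X) (i : hom I X) :
  kernel_mor a -> kernel_mor b -> is_meet a b i ->
  [/\ kernel_mor i, exists u, a ∘ u = i, exists v, b ∘ v = i
    & forall T (u : hom T A) (v : hom T B), a ∘ u = b ∘ v -> exists h, i ∘ h = a ∘ u].
Proof.
move=> ka [Y [f /kernelP[fb mb bE]]] [p [q [[e pU] ->]]]; split.
- apply: kernel_mor_comp => //; exists Y, (f ∘ a); apply/kernelP; split.
  + by rewrite -compmA e compmA fb comp0m.
  + move=> T x y epq; have [|h [_ hU]] := pU T (p ∘ x) (q ∘ x).
      by rewrite !compmA e.
    rewrite -(hU x) // (hU y) //; split=> //.
    by apply: mb; rewrite !compmA -e -!compmA epq.
  + move=> T t; rewrite -compmA => /bE [v bv].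
    by have [|h [[ht _] _]] := pU T t v; [|exists h].
- by exists p.
- by exists q.
move=> T u v /pU [h [[hu _] _]]; exists h.
by rewrite -compmA hu.
Qed.

Lemma meet_ex (X A B : C) (a : hom A X) (b : hom B X) : exists I (i : hom I X), is_meet a b i.
Proof.
by have [P [u [v pb]]] := pullback_ex a b; exists P, (a ∘ u), u, v.
Qed.

(** A strict subobject is the kernel of some morphism out of [X], so containment can be tested by
    such morphisms. The inclusion of A + (B ∩ D) in B ∩ (A + D) always exists, and the law amounts
    to the reverse containment. *)
Lemma modular_lawP : modular_law C <-> modular_kernels.
Proof.
split=> mod.
  move=> X A D Y W a d beta w ka kd ba bw aw T t ta td.
  have [B [b kb]] := ker_ex beta; have [bb mb bE] := (kernelP _ _).1 kb.
  have {}kb : kernel_mor b by exists Y, beta.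
  have [a' e] := bE _ _ ba; move: ta ka aw; rewrite -{}e => ta ka aw.
  have [BD [bd mbd]] := meet_ex b d; have [S [s js]] := join_ex (b ∘ a') bd.
  have [AD [ad jad]] := join_ex (b ∘ a') d; have [U [u mu]] := meet_ex b ad.
  have [m [um [m' [_ mm']]]] :
      exists m : hom S U, u ∘ m = s /\ is_iso m.
    apply: (mod X A B D a' b d) mbd js jad mu; apply/strict_subP => //.
    exact: kernel_mor_cancel ka.
  have [kad [x adx] [y ady] adU] := joinP jad.
  have [_ _ _ sU] := joinP js.
  have [_ _ _ uU] := meetP kb kad mu.
  have [kbd [bdl bdlE] [bdr bdrE] _] := meetP kb kd mbd.
  have [w1 bw1] := bE _ _ bw.
  have [w2 aw2] : exists w2, ad ∘ w2 = w.
    have [R [r /kernelP[rad mad adE]]] := kad; apply: adE; apply: aw.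
      by rewrite -adx compmA rad comp0m.
    by rewrite -ady compmA rad comp0m.
  have [|w3 uw] := uU _ w1 w2; first by rewrite aw2.
  (* Through the inverse of [m] the arrow [w] factors through A + (B ∩ D), on which [t] vanishes
     because it vanishes on both summands. *)
  rewrite -bw1 -uw -[u]compm1 -mm' (compmA u) um -compmA compmA.
  rewrite sU ?comp0m // -bdrE compmA; apply: td.
  by rewrite -compmA bdrE -bdlE compmA bb comp0m.
move=> X A B D a b d /strict_subP ka /strict_subP kb /strict_subP kd.
move=> BD AD S U bd s ad u mbd js jad mu.
have [kbd [bdl bdlE] [bdr bdrE] bdU] := meetP kb kd mbd.
have [ks [sa saE] [sbd sbdE] sU] := joinP js.
have [kad [ada adaE] [adb adbE] adU] := joinP jad.
have [ku [ub ubE] [uad uadE] uU] := meetP kb kad mu.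
have [sq [c ksq]] := ks; have [uq [g kuq]] := ku.
move/kernelP: ksq => [cs ms sE]; move/kernelP: kuq => [gu mu' uE].
have [m um] : exists m, u ∘ m = s.
  apply: uE; apply: sU.
    have [|z uz] := uU _ a ada; first by rewrite adaE.
    by rewrite -uz compmA gu comp0m.
  have [|z uz] := uU _ bdl (adb ∘ bdr); first by rewrite compmA adbE bdlE bdrE.
  by rewrite -bdlE -uz compmA gu comp0m.
exists m; split=> //.
have [Y [beta kbeta]] := kb; move/kernelP: kbeta => [bb mb bE].
have [n sn] : exists n, s ∘ n = u.
  apply: sE; apply: (mod X A D Y _ (b ∘ a) d beta) => //.
  - exact: kernel_mor_comp.
  - by rewrite compmA bb comp0m.
  - by rewrite -ubE compmA bb comp0m.
  - by move=> T t ta td; rewrite -uadE compmA adU ?comp0m.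
  - by rewrite -saE compmA cs comp0m.
  move=> V v; rewrite -compmA => /bE[x bx].
  have [z bdz] := bdU _ _ _ bx.
  by rewrite -compmA -bx -bdz -sbdE !compmA cs !comp0m.
exists n; split; [apply: ms|apply: mu'].
  by rewrite compmA sn um compm1.
by rewrite compmA um sn compm1.
Qed.

End AdditiveCategory.
End Additive.
Import Additive.

(** * Filtered objects *)

Section Filtered.
Variables (A : category) (add : forall X Y : A, GRing.Zmodule (hom X Y)).
Hypothesis bil : bilinear_comp add.
Hypothesis zero_ex : exists Z : A, is_zero_obj Z.
Hypothesis bip_ex : forall X Y : A, exists S (i : hom X S) (j : hom Y S)
  (p : hom S X) (q : hom S Y), is_biproduct add i j p q.
Hypothesis ker_ex : has_kernels A.
Hypothesis coker_ex : has_cokernels A.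
Hypothesis pushout_stable :
  forall (X Y Z P : A) (f : hom Z X) (g : hom Z Y) (p : hom X P) (q : hom Y P),
    is_pushout f g p q -> kernel_mor f -> kernel_mor q.

Local Notation "f + g" := (addm add f g) : cat_scope.
Local Notation "0" := (zerom add _ _) : cat_scope.
Local Notation "- f" := (oppm add f) : cat_scope.

Let comp0m := @comp0m A add bil.
Let compm0 := @compm0 A add bil.
Let compDm := @compDm A add bil.
Let compmD := @compmD A add bil.
Let compNm := @compNm A add bil.
Let compmN := @compmN A add bil.
Let addm0 := @addm0 A add.
Let add0m := @add0m A add.
Let addmN := @addmN A add.
Let zero_objP := @zero_objP A add bil.
Let kernelP := @kernelP A add bil zero_ex.
Let cokernelP := @cokernelP A add bil zero_ex.
Let kernel_mor_monic := @kernel_mor_monic A add bil zero_ex.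
Let cokernel_mor_epic := @cokernel_mor_epic A add bil zero_ex.
Let monic0 := @monic0 A add bil.
Let strict_subP := @strict_subP A add bil zero_ex ker_ex coker_ex.
Let iso_kernel_mor := @iso_kernel_mor A add bil zero_ex.
Let kernel_mor_sum := @kernel_mor_sum A add bil zero_ex bip_ex.
Let kernel_mor_cancel := @kernel_mor_cancel A add bil zero_ex bip_ex coker_ex pushout_stable.
Let kernel_mor_comp := @kernel_mor_comp A add bil zero_ex bip_ex coker_ex pushout_stable.

(** * The index order and finite sets of breaks *)

Variables (d : Order.disp_t) (L : porderType d) (l0 : L).
Hypothesis L_total : total (<=%O : rel L).
Hypothesis L_dense : forall x y : L, (x < y)%O -> exists z, (x < z < y)%O.
Hypothesis L_nomin : forall x : L, exists y, (y < x)%O.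
Hypothesis L_nomax : forall x : L, exists y, (x < y)%O.

Lemma le_or_lt (x y : L) : (x <= y)%O \/ (y < x)%O.
Proof.
case: (boolP (x <= y)%O) => xy; [by left|right].
have := L_total x y; rewrite (negPf xy) /= lt_neqAle => ->; rewrite andbT.
by apply: contraNneq xy => ->.
Qed.

Lemma seq_upper_bound (bs : seq L) : exists h, forall b, b \in bs -> (b <= h)%O.
Proof.
elim: bs => [|b bs [h hP]]; first by exists l0.
case: (le_or_lt b h) => bh.
  by exists h => x; rewrite inE => /predU1P[->|/hP].
exists b => x; rewrite inE => /predU1P[->//|/hP xh].
exact: le_trans xh (ltW bh).
Qed.

Lemma seq_lower_bound (bs : seq L) : exists l, forall b, b \in bs -> (l < b)%O.
Proof.
elim: bs => [|b bs [h hP]]; first by exists l0.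
case: (le_or_lt b h) => bh.
  have [l lb] := L_nomin b; exists l => x; rewrite inE => /predU1P[->//|/hP].
  exact/lt_trans/(lt_le_trans lb).
by exists h => x; rewrite inE => /predU1P[->|/hP].
Qed.

(** Density and the absence of a maximum leave room to the right of [l] before the next of finitely
    many breaks. Right continuity rests on this. *)
Lemma break_free_above (bs : seq L) (l : L) :
  exists2 m, (l < m)%O & forall b, b \in bs -> ~ (l < b <= m)%O.
Proof.
elim: bs => [|b bs [m lm mP]]; first by have [m] := L_nomax l; exists m.
case: (le_or_lt b l) => lb.
  exists m => // x; rewrite inE => /predU1P[->|/mP//].
  by move=> /andP[/lt_le_trans/(_ lb)]; rewrite ltxx.
have [z /andP[lz zb]] := L_dense lb.
case: (le_or_lt m z) => mz.
  exists m => // x; rewrite inE => /predU1P[->|/mP//] /andP[_ bm].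
  by have := lt_le_trans zb (le_trans bm mz); rewrite ltxx.
exists z => // x; rewrite inE => /predU1P[->|/mP xP] /andP[lx xz].
  by have := lt_le_trans zb xz; rewrite ltxx.
by apply: xP; rewrite lx (le_trans xz) // ltW.
Qed.

(** * Finite filtrations as families of strict subobjects *)

Implicit Types F G : functor (poset_cat L) A.

Definition tr F (l m : L) (lm : (l <= m)%O) : hom (F l) (F m) :=
  @fmap (poset_cat L) A F l m lm.

Lemma tr_comp F l m n (lm : (l <= m)%O) (mn : (m <= n)%O) (ln : (l <= n)%O) :
  tr F mn ∘ tr F lm = tr F ln.
Proof.
by rewrite /tr -fmapM; congr (fmap F _); apply: bool_irrelevance.
Qed.

(* The shape of a finite filtration, relative to a superset [bs] of its breaks. *)
Definition broken_at F (bs : seq L) : Prop :=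
  (forall l, (forall b, b \in bs -> (l < b)%O) -> is_zero_obj (F l)) /\
  (forall l m (lm : (l <= m)%O),
     (forall b, b \in bs -> ~ (l < b <= m)%O) -> is_iso (tr F lm)).

(** An elementary form of exhaustiveness for finite filtrations: in place of the colimit property,
    some leg of a cocone of kernels is an isomorphism. *)
Definition vertex F V (c : forall l, hom (F l) V) : Prop :=
  [/\ forall l m (lm : (l <= m)%O), c m ∘ tr F lm = c l,
      forall l, kernel_mor (c l) & exists h, is_iso (c h)].

Definition fil F : Prop :=
  (exists V (c : forall l, hom (F l) V), vertex c) /\ exists bs, broken_at F bs.

Section Vertex.
Variables (F : functor (poset_cat L) A) (V : A) (c : forall l, hom (F l) V).
Hypothesis cP : vertex c.

Lemma vertex_tr l m (lm : (l <= m)%O) : c m ∘ tr F lm = c l.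
Proof. by case: cP. Qed.

Lemma vertex_kernel l : kernel_mor (c l).
Proof. by case: cP. Qed.

Lemma vertex_monic l : monic (c l).
Proof. exact/kernel_mor_monic/vertex_kernel. Qed.

Lemma tr_kernel l m (lm : (l <= m)%O) : kernel_mor (tr F lm).
Proof. by apply: (kernel_mor_cancel (g := c m)); rewrite vertex_tr; apply: vertex_kernel. Qed.

Lemma tr_monic l m (lm : (l <= m)%O) : monic (tr F lm).
Proof. exact/kernel_mor_monic/tr_kernel. Qed.

Lemma vertex_iso_le l m : (l <= m)%O -> is_iso (c l) -> is_iso (c m).
Proof.
move=> lm; rewrite -(vertex_tr lm) => /iso_cancel_monic [] //.
exact: vertex_monic.
Qed.

Lemma vertex_iso bs l :
  broken_at F bs -> (forall b, b \in bs -> (b <= l)%O) -> is_iso (c l).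
Proof.
move=> [_ brk] bl; have [_ _ [h ch]] := cP.
case: (le_or_lt h l) => hl; first exact: vertex_iso_le ch.
rewrite -(vertex_tr (ltW hl)); apply: iso_comp => //; apply: brk => b /bl b_le.
by move=> /andP[/lt_le_trans/(_ b_le)]; rewrite ltxx.
Qed.

(** A cocone is determined by its component at [h]: earlier values map to [F h], and the transitions
    after [h] are isomorphisms. *)
Lemma vertex_colimit : is_colimit (D := F) c.
Proof.
have [ctr _ [h ch]] := cP; split; first by move=> l m lm; apply: ctr.
move=> T q qc; have [v [vc cv]] := ch.
exists (q h ∘ v); split=> [l|u uq]; last first.
  by rewrite -(uq h) -compmA cv compm1.
case: (le_or_lt l h) => lh.
  rewrite -(vertex_tr lh) -compmA (compmA v) vc comp1m; exact: qc.
have hl := ltW lh; have cl : is_iso (c l) by apply: vertex_iso_le ch.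
have tri : is_iso (tr F hl).
  by move: (ch); rewrite -(vertex_tr hl) => /iso_cancel_monic[] //; apply: vertex_monic.
apply: (iso_epic tri); rewrite -compmA vertex_tr -compmA vc compm1.
by rewrite -(qc h l hl).
Qed.

Lemma vertex_epi T (u v : hom V T) : (forall l, u ∘ c l = v ∘ c l) -> u = v.
Proof.
have [_ _ [h ch]] := cP => uv; exact: (iso_epic ch).
Qed.

End Vertex.

(** Let [h] bound the breaks and let [c h] be the kernel of [g]. Earlier legs factor through [c h]
    and transitions after [h] are isomorphisms, so [g] kills every leg. The colimit property gives
    that [g] is zero, hence [c h] is invertible. *)
Lemma filtration_fil F : is_filtration F -> finite_filtration F -> fil F.
Proof.
move=> [[V [c [[cc cU] cs]]] _ _] [bs [_ z brk]].
have bP : broken_at F bs by split=> // l m lm b; apply/brk.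
split; last by exists bs.
exists V, c; split=> [l m lm|l|]; [exact: cc| exact/strict_subP|].
have [h hP] := seq_upper_bound bs; exists h.
have [Y [g /kernelP[gc mc cE]]] : kernel_mor (c h) by apply/strict_subP.
have g0 : g = 0.
  have [|x [_ xU]] := cU Y (fun l => 0); first by move=> l m lm; rewrite comp0m.
  rewrite -(xU 0); last by move=> l; rewrite comp0m.
  symmetry; apply: xU => l; case: (le_or_lt l h) => lh.
    by rewrite -(cc l h lh) compmA gc comp0m.
  have tri : is_iso (tr F (ltW lh)).
    apply: (proj2 bP) => b /hP bh /andP[/lt_le_trans/(_ bh)].
    by rewrite ltxx.
  apply: (iso_epic tri); rewrite -compmA (cc h l (ltW lh)) gc.
  by rewrite comp0m.
have [|s cs'] := cE _ (idm V); first by rewrite g0 comp0m.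
exact: monic_section cs'.
Qed.

(** The list [bs] may contain spurious entries. Those [b] are kept that no transition from a
    strictly smaller index reaches by an isomorphism. *)
Lemma broken_at_breaks F bs V (c : forall l, hom (F l) V) :
  vertex c -> broken_at F bs -> finite_filtration F.
Proof.
move=> cP [z brk]; pose jump b := forall l (lb : (l <= b)%O), (l < b)%O -> ~ is_iso (tr F lb).
pose bs' := [seq b <- bs | `[< jump b >]].
have brk' l m (lm : (l <= m)%O) :
    (forall b, b \in bs' -> ~ (l < b <= m)%O) -> is_iso (tr F lm).
  (* Induction on the length of a list containing the entries of [bs] in the interval: a spurious
     [b] splits the interval into two, each with fewer entries. *)
  have [s] : exists s : seq L, forall b, b \in bs -> (l < b <= m)%O -> b \in s by exists bs.
  have [n] := ubnP (size s); elim: n => // n IHn in l m lm s *.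
  rewrite ltnS => sn sP no'.
  case: (pselect (exists2 b, b \in bs & (l < b <= m)%O)) => [[b bbs lbm]|no]; last first.
    by apply: brk => b bbs lbm; apply: no; exists b.
  have bs1 : b \in s by apply: sP.
  have srem : (size (rem b s) < n)%N by rewrite size_rem // prednK //; case: (s) bs1.
  have [l' [l'b [l'b' ii]]] : exists l' (lb : (l' <= b)%O), (l' < b)%O /\ is_iso (tr F lb).
    have : ~ jump b by move=> jb; apply: (no' b) => //; rewrite mem_filter bbs andbT; apply/asboolP.
    apply: contra_notP => H l' lb lb' ii; apply: H; by exists l', lb.
  move: lbm => /andP[lb bm].
  (* [l''] is the later of [l] and [l']. When it is [l], the isomorphism from [l'] to [b] factors
     through the monic transition from [l] to [b]. *)
  have [l'' [ll'' [l''b l''i]]] : exists l'' : L, (l <= l'')%O /\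
       exists l''b : (l'' < b)%O, is_iso (tr F (ltW l''b)).
    case: (le_or_lt l l') => ll'; [exists l'|exists l]; split=> //.
      exists l'b'; move: ii; congr (is_iso (tr F _)); exact: bool_irrelevance.
    exists lb; move: ii; rewrite -(tr_comp F (ltW ll') (ltW lb)).
    move/iso_cancel_monic; case=> //; exact: (tr_monic cP).
  have sub x : x \in s -> x != b -> x \in rem b s.
    by move=> xs xb; move: xs; rewrite (perm_mem (perm_to_rem bs1)) inE (negPf xb).
  have i1 : is_iso (tr F ll'').
    apply: (IHn _ _ _ (rem b s)) => // x.
      move=> xbs /andP[lx xl]; apply: sub.
        by apply: sP; rewrite // lx (le_trans xl) // ltW // (lt_le_trans l''b).
      by rewrite lt_eqF // (le_lt_trans xl).
    move=> xbs /andP[lx xl]; apply: (no' x) => //.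
    by rewrite lx (le_trans xl) // ltW // (lt_le_trans l''b).
  have i2 : is_iso (tr F bm).
    apply: (IHn _ _ _ (rem b s)) => // x.
      move=> xbs /andP[bx xm]; apply: sub.
        by apply: sP; rewrite // xm (lt_trans lb).
      by rewrite gt_eqF.
    by move=> xbs /andP[bx xm]; apply: (no' x) => //; rewrite xm (lt_trans lb).
  rewrite -(tr_comp F (le_trans ll'' (ltW l''b)) bm); apply: iso_comp => //.
  by rewrite -(tr_comp F ll'' (ltW l''b)); apply: iso_comp.
have mem b : (b \in sort <=%O (undup bs')) = (b \in bs') by rewrite mem_sort mem_undup.
exists (sort <=%O (undup bs')); split.
- by rewrite lt_sorted_uniq_le sort_uniq undup_uniq sort_sorted.
(* With [l1] below [l] and below all of [bs], the value at [l1] is zero, and no genuine break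
   separates [l1] from [l]. *)
- move=> l lb; have [l1 l1b] := seq_lower_bound (l :: bs).
  have l1l : (l1 <= l)%O by rewrite ltW // l1b // mem_head.
  have /zero_objP l1z : is_zero_obj (F l1).
    by apply: z => b bbs; apply: l1b; rewrite inE bbs orbT.
  have [|u [_ tu]] := brk' _ _ l1l.
    move=> b; rewrite -mem => /lb lb' /andP[_ /(lt_le_trans lb')].
    by rewrite ltxx.
  apply/zero_objP; rewrite -tu -[tr F l1l]compm1 (_ : idm _ = 0) //.
  by rewrite compm0 comp0m.
move=> l m lm; split=> [ii b|no]; last by apply: brk' => b; rewrite -mem; apply: no.
rewrite mem mem_filter => /andP[/asboolP jb _] /andP[lb bm].
apply: (jb _ (ltW lb) lb); move: ii; rewrite -/(tr F lm) -(tr_comp F (ltW lb) bm).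
by move/iso_cancel_monic; case=> //; apply: (tr_monic cP).
Qed.

Lemma fil_filtration F : fil F -> is_filtration F /\ finite_filtration F.
Proof.
move=> [[V [c cP]] [bs bP]]; split; last exact: broken_at_breaks cP bP.
have [z brk] := bP; have [ctr ck ci] := cP.
split.
- exists V, c; split; first exact: vertex_colimit.
  by move=> l; apply/strict_subP.
(* Separatedness: every component of a cone factors through a value below all breaks, which is
   zero. *)
- have [l lb] := seq_lower_bound bs; have Fl := z _ lb.
  exists (F l), (fun m => 0); split=> //; split; first by move=> i j u; rewrite compm0.
  move=> T q qc; have [[u [_ uU]] _] := Fl T.
  exists u; split=> [m|v _]; last exact: uU.
  rewrite comp0m; have [l1 l1b] := seq_lower_bound ((m : L) :: bs).
  have l1m : (l1 <= m)%O by rewrite ltW // l1b // mem_head.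
  have /zero_objP l1z : is_zero_obj (F l1).
    by apply: z => b bbs; apply: l1b; rewrite inE bbs orbT.
  by rewrite -(qc l1 m l1m) -[q l1]comp1m l1z comp0m compm0.
move=> l; split=> [[i li] [j lj] /= ij|T q qc]; first exact: tr_comp.
(* Right continuity: [F] is constant from [l] to [m0], so a cone over the indices above [l] is
   determined by its component at [m0], carried back to [F l] by the inverse [g]. *)
have [m0 lm0 m0P] := break_free_above bs l.
have [g [gt tg]] := brk _ _ (ltW lm0) m0P.
pose M0 : above l := exist _ m0 lm0.
have qE m (lm : (l < m)%O) : tr F (ltW lm) ∘ (g ∘ q M0 : hom T (F l)) = q (exist _ m lm : above l) :> hom T (F m).
  case: (le_or_lt m0 m) => mm.
    rewrite -(qc M0 (exist _ m lm : above l) mm) -(tr_comp F (ltW lm0) mm).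
    by rewrite -[LHS]compmA (compmA _ g) tg comp1m.
  apply: (tr_monic cP (lm := ltW mm)); rewrite compmA (tr_comp F _ _ (ltW lm0)).
  rewrite compmA tg comp1m; symmetry; exact: (qc (exist _ m lm : above l) M0 (ltW mm)).
have qE' (m : above l) : trans_above F m ∘ (g ∘ q M0) = q m.
  case: m => m lm; apply: etrans (qE m lm).
  exact: (congr1 (fun lm' => tr F lm' ∘ (g ∘ q M0)) (bool_irrelevance _ (ltW lm))).
exists (g ∘ q M0); split=> [m|h hq]; first exact: qE'.
apply: (tr_monic cP (lm := ltW (svalP M0))).
by have := etrans (qE' M0) (esym (hq M0)).
Qed.

Lemma filP F : is_filtration F /\ finite_filtration F <-> fil F.
Proof. by split=> [[]|]; [apply: filtration_fil|apply: fil_filtration]. Qed.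

(** * Filtrations built from families of subobjects *)

Local Notation W := (Wpre A L).

Section Family.
Variables (V : A) (S : L -> A) (c : forall l, hom (S l) V) (bs : seq L).
Hypothesis c_kernel : forall l, kernel_mor (c l).
Hypothesis c_mono : forall l m, (l <= m)%O -> exists u, c m ∘ u = c l.
Hypothesis c_zero : forall l, (forall b, b \in bs -> (l < b)%O) -> is_zero_obj (S l).
(** A lift of the larger subobject through the smaller one is enough: the [c l] are monic, so it is
    inverse to the transition. Likewise the lift in [c_full] inverts [c l]. *)
Hypothesis c_const : forall l m, (l <= m)%O ->
  (forall b, b \in bs -> ~ (l < b <= m)%O) -> exists u, c l ∘ u = c m.
Hypothesis c_full : forall l, (forall b, b \in bs -> (b <= l)%O) ->
  exists u, c l ∘ u = idm V.

Definition fam_tr l m (lm : (l <= m)%O) : hom (S l) (S m) := sval (cid (c_mono lm)).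

Lemma fam_trE l m (lm : (l <= m)%O) : c m ∘ fam_tr lm = c l.
Proof. exact: svalP (cid (c_mono lm)). Qed.

Lemma fam_tr1 (l : poset_cat L) : fam_tr (idm l) = idm (S l).
Proof. by apply: (kernel_mor_monic (c_kernel l)); rewrite fam_trE compm1. Qed.

Lemma fam_trM (l m n : poset_cat L) (mn : hom m n) (lm : hom l m) :
  fam_tr (mn ∘ lm) = fam_tr mn ∘ fam_tr lm.
Proof. by apply: (kernel_mor_monic (c_kernel n)); rewrite compmA !fam_trE. Qed.

Definition fam_functor : functor (poset_cat L) A :=
  @Functor (poset_cat L) A S fam_tr fam_tr1 fam_trM.

Lemma fam_vertex : vertex (F := fam_functor) c.
Proof.
split=> [l m lm|l|]; [exact: fam_trE|exact: c_kernel|].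
have [h hP] := seq_upper_bound bs; exists h; have [u cu] := c_full hP.
exact: monic_section (kernel_mor_monic (c_kernel h)) cu.
Qed.

Lemma fam_broken : broken_at fam_functor bs.
Proof.
split=> // l m lm no; have [u cu] := c_const lm no; exists u; split.
  by apply: (kernel_mor_monic (c_kernel l)); rewrite compmA cu fam_trE compm1.
by apply: (kernel_mor_monic (c_kernel m)); rewrite compmA fam_trE cu compm1.
Qed.

Lemma fam_fil : is_filtration fam_functor /\ finite_filtration fam_functor.
Proof.
apply/filP; split; first by exists V, c; apply: fam_vertex.
by exists bs; apply: fam_broken.
Qed.

Definition fam_obj : W := exist _ fam_functor fam_fil.

End Family.

(** * The group structure on morphisms of filtrations *)

Definition gr (M : W) : L -> A := fun l => sval M l.

Definition cmp (M N : W) (f : hom M N) (l : L) : hom (gr M l) (gr N l) :=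
  @ntc (poset_cat L) A (sval M) (sval N) f l.

Definition gtr (M : W) l m (lm : (l <= m)%O) : hom (gr M l) (gr M m) := tr (sval M) lm.

Lemma cmp_tr (M N : W) (f : hom M N) l m (lm : (l <= m)%O) :
  cmp f m ∘ gtr M lm = gtr N lm ∘ cmp f l.
Proof. exact: (@ntP (poset_cat L) A (sval M) (sval N) f l m lm). Qed.

Lemma cmp_inj (M N : W) (f g : hom M N) : (forall l, cmp f l = cmp g l) -> f = g.
Proof. by move=> fg; apply: nat_trans_eq => l; apply: fg. Qed.

Lemma cmp_comp (M N P : W) (g : hom N P) (f : hom M N) l :
  cmp (g ∘ f) l = cmp g l ∘ cmp f l.
Proof. by []. Qed.

Lemma cmp_idm (M : W) l : cmp (idm M) l = idm (gr M l).
Proof. by []. Qed.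

Lemma mor_ex (M N : W) (f : forall l, hom (gr M l) (gr N l)) :
  (forall l m (lm : (l <= m)%O), f m ∘ gtr M lm = gtr N lm ∘ f l) ->
  exists g : hom M N, forall l, cmp g l = f l.
Proof. by move=> fP; exists (@NatTrans (poset_cat L) A (sval M) (sval N) f fP). Qed.

Section ZmoduleOfMorphisms.
Variables M N : W.

Lemma cmp_add_subproof (f g : hom M N) l m (lm : (l <= m)%O) :
  (cmp f m + cmp g m) ∘ gtr M lm = gtr N lm ∘ (cmp f l + cmp g l).
Proof. by rewrite compDm compmD !cmp_tr. Qed.

Lemma cmp_opp_subproof (f : hom M N) l m (lm : (l <= m)%O) :
  (- cmp f m) ∘ gtr M lm = gtr N lm ∘ (- cmp f l).
Proof. by rewrite compNm compmN cmp_tr. Qed.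

Lemma cmp_zero_subproof l m (lm : (l <= m)%O) :
  (0 : hom (gr M m) (gr N m)) ∘ gtr M lm = gtr N lm ∘ 0.
Proof. by rewrite comp0m compm0. Qed.

Definition addW_op (f g : hom M N) : hom M N :=
  @NatTrans (poset_cat L) A (sval M) (sval N) _ (cmp_add_subproof f g).
Definition oppW_op (f : hom M N) : hom M N :=
  @NatTrans (poset_cat L) A (sval M) (sval N) _ (cmp_opp_subproof f).
Definition zeroW_op : hom M N :=
  @NatTrans (poset_cat L) A (sval M) (sval N) _ cmp_zero_subproof.

Lemma addW_A : associative addW_op.
Proof. by move=> f g h; apply: cmp_inj => l; apply: addmA. Qed.
Lemma addW_C : commutative addW_op.
Proof. by move=> f g; apply: cmp_inj => l; apply: addmC. Qed.
Lemma addW_0 : left_id zeroW_op addW_op.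
Proof. by move=> f; apply: cmp_inj => l; apply: add0m. Qed.
Lemma addW_N : left_inverse zeroW_op oppW_op addW_op.
Proof. by move=> f; apply: cmp_inj => l; rewrite addW_C; apply: addmN. Qed.

Definition addW : GRing.Zmodule (hom M N) := zmodule_of_laws addW_A addW_C addW_0 addW_N.

End ZmoduleOfMorphisms.

Lemma cmp_add (M N : W) (f g : hom M N) l : cmp (addm addW f g) l = cmp f l + cmp g l.
Proof. by []. Qed.

Lemma cmp_zero (M N : W) l : cmp (zerom addW M N) l = 0.
Proof. by []. Qed.

Lemma cmp_opp (M N : W) (f : hom M N) l : cmp (oppm addW f) l = - cmp f l.
Proof. by []. Qed.

Lemma bilW : bilinear_comp addW.
Proof.
split=> M N P.
  by move=> g g' f; apply: cmp_inj => l; rewrite cmp_add !cmp_comp cmp_add compDm.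
by move=> g f f'; apply: cmp_inj => l; rewrite cmp_add !cmp_comp cmp_add compmD.
Qed.

Lemma zeroW_ex : exists Z : W, is_zero_obj Z.
Proof.
have [Z Z0] := zero_ex; have idZ := (zero_objP Z).1 Z0.
have iZ (l m : L) : (l <= m)%O -> exists u, idm Z ∘ u = idm Z.
  by exists (idm Z); rewrite comp1m.
pose c (l : L) := idm Z.
have ck l : kernel_mor (c l) by apply/iso_kernel_mor/iso_idm.
exists (@fam_obj Z (fun=> Z) c [::] ck iZ (fun _ _ => Z0) (fun l m lm _ => iZ l m lm)
          (fun l _ => iZ l l (lexx l))).
by apply/(Additive.zero_objP bilW); apply: cmp_inj.
Qed.

(** * Underlying objects and underlying maps *)

Record summit (M : W) := Summit {
  top : A;
  inc : forall l, hom (gr M l) top;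
  incP : vertex (F := sval M) inc }.

Arguments inc {M} s l.

Lemma summit_ex (M : W) : exists _ : summit M, True.
Proof.
have [[V [c cP]] _] := (filP (sval M)).1 (svalP M).
by exists (Summit cP).
Qed.

(** Only a default choice: constructions such as cokernels come with a summit of their own, so the
    maps of tops below take summits as arguments. *)
Definition apex (M : W) : summit M := sval (cid (summit_ex M)).

Section Summit.
Variables (M : W) (s : summit M).

Lemma inc_tr l m (lm : (l <= m)%O) : inc s m ∘ gtr M lm = inc s l.
Proof. exact: vertex_tr (incP s) l m lm. Qed.

Lemma inc_kernel l : kernel_mor (inc s l).
Proof. exact: vertex_kernel (incP s) l. Qed.

Lemma inc_monic l : monic (inc s l).
Proof. exact/kernel_mor_monic/inc_kernel. Qed.

Lemma gtr_monic l m (lm : (l <= m)%O) : monic (gtr M lm).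
Proof. exact: (tr_monic (incP s)). Qed.

Lemma inc_epi T (u v : hom (top s) T) : (forall l, u ∘ inc s l = v ∘ inc s l) -> u = v.
Proof. exact: vertex_epi (incP s) T u v. Qed.

Lemma inc_iso_le l m : (l <= m)%O -> is_iso (inc s l) -> is_iso (inc s m).
Proof. exact: vertex_iso_le (incP s) l m. Qed.

Lemma inc_iso_ex : exists h, is_iso (inc s h).
Proof. by case: (incP s). Qed.

Lemma inc_iso bs l : broken_at (sval M) bs -> (forall b, b \in bs -> (b <= l)%O) ->
  is_iso (inc s l).
Proof. exact: vertex_iso (incP s) bs l. Qed.

End Summit.

Lemma gtr_iso (M : W) bs l m (lm : (l <= m)%O) :
  broken_at (sval M) bs -> (forall b, b \in bs -> ~ (l < b <= m)%O) -> is_iso (gtr M lm).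
Proof. by move=> bP; apply: (proj2 bP). Qed.

Lemma broken_ex (M : W) : exists bs, broken_at (sval M) bs.
Proof. by have [] := (filP (sval M)).1 (svalP M). Qed.

Section TopMap.
Variables (M N : W) (s : summit M) (t : summit N).

Lemma tmap_ex (f : hom M N) : exists g : hom (top s) (top t),
  forall l, g ∘ inc s l = inc t l ∘ cmp f l.
Proof.
have [_ sU] := vertex_colimit (incP s).
have [|g [gP _]] := sU (top t) (fun l => inc t l ∘ cmp f l); last by exists g.
move=> l m lm; rewrite -compmA (cmp_tr f lm) compmA; congr (_ ∘ _).
exact: inc_tr.
Qed.

Definition tmap (f : hom M N) : hom (top s) (top t) := sval (cid (tmap_ex f)).

Lemma tmapE f l : tmap f ∘ inc s l = inc t l ∘ cmp f l.
Proof. exact: (svalP (cid (tmap_ex f)) l). Qed.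

Lemma tmap_eq f g : (forall l, g ∘ inc s l = inc t l ∘ cmp f l) -> tmap f = g.
Proof. by move=> gP; apply: (@inc_epi _ s) => l; rewrite tmapE gP. Qed.

Lemma tmap_add f g : tmap (addm addW f g) = tmap f + tmap g.
Proof. by apply: tmap_eq => l; rewrite compDm !tmapE cmp_add compmD. Qed.

Lemma tmap_opp f : tmap (oppm addW f) = - tmap f.
Proof. by apply: tmap_eq => l; rewrite compNm !tmapE cmp_opp compmN. Qed.

Lemma tmap_zero : tmap (zerom addW M N) = 0.
Proof. by apply: tmap_eq => l; rewrite cmp_zero comp0m compm0. Qed.

Lemma tmap_inj f g : tmap f = tmap g -> f = g.
Proof. by move=> fg; apply: cmp_inj => l; apply: (@inc_monic _ t); rewrite -!tmapE fg. Qed.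

(** The levelwise lifts commute with the transitions because the inclusions into the top are
    monic. *)
Lemma tmap_ex_lift (g : hom (top s) (top t)) :
  (forall l, exists u, inc t l ∘ u = g ∘ inc s l) -> exists f, tmap f = g.
Proof.
move=> lift; pose u l := sval (cid (lift l)).
have uE l : inc t l ∘ u l = g ∘ inc s l by apply: (svalP (cid (lift l))).
have [|f fE] := @mor_ex M N u; last by exists f; apply: tmap_eq => l; rewrite fE uE.
move=> l m lm; apply: (@inc_monic _ t).
by rewrite !compmA uE inc_tr uE -compmA inc_tr.
Qed.

End TopMap.

Lemma tmap_comp (M N P : W) (s : summit M) (t : summit N) (r : summit P)
    (g : hom N P) (f : hom M N) : tmap s r (g ∘ f) = tmap t r g ∘ tmap s t f.
Proof. by apply: tmap_eq => l; rewrite -compmA tmapE compmA tmapE -compmA. Qed.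

Lemma tmap_idm (M : W) (s : summit M) : tmap s s (idm M) = idm _.
Proof. by apply: tmap_eq => l; rewrite comp1m cmp_idm compm1. Qed.

(** * Biproducts in [Wpre] *)

Record biproduct_data (X Y : A) := BiproductData {
  bd_obj : A;
  bd_inl : hom X bd_obj;
  bd_inr : hom Y bd_obj;
  bd_prl : hom bd_obj X;
  bd_prr : hom bd_obj Y;
  bdP : is_biproduct add bd_inl bd_inr bd_prl bd_prr }.

(** Biproducts are formed levelwise and included in the biproduct [V] of the tops, with the breaks
    of both summands. As [tmap] is injective on morphisms, the biproduct identities reduce to those
    of [V]. *)
Lemma bipW_ex (M N : W) : exists S (i : hom M S) (j : hom N S)
  (p : hom S M) (q : hom S N), is_biproduct addW i j p q.
Proof.
have H l : exists _ : biproduct_data (gr M l) (gr N l), True.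
  by have [S [i [j [p [q b]]]]] := bip_ex (gr M l) (gr N l); exists (BiproductData b).
pose B l := sval (cid (H l)); pose S l := bd_obj (B l).
pose i l : hom _ (S l) := bd_inl (B l); pose j l : hom _ (S l) := bd_inr (B l).
pose p l : hom (S l) _ := bd_prl (B l); pose q l : hom (S l) _ := bd_prr (B l).
have BP l : is_biproduct add (i l) (j l) (p l) (q l) by apply: (bdP (B l)).
have [bs bP] := broken_ex M; have [bs' bP'] := broken_ex N.
have [V [iV [jV [pV [qV bV]]]]] := bip_ex (top (apex M)) (top (apex N)).
pose c l := iV ∘ inc (apex M) l ∘ p l + jV ∘ inc (apex N) l ∘ q l.
have [pi qj pj qi bVE] := bV.
have ck l : kernel_mor (c l).
  by apply: (kernel_mor_sum (BP l) bV); apply: inc_kernel.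
(* One identity for two uses: with transitions as [u] and [v] it gives monotonicity, with their
   inverses constancy between breaks. *)
have step l m (u : hom (gr M l) (gr M m)) (v : hom (gr N l) (gr N m)) :
    inc (apex M) m ∘ u = inc (apex M) l -> inc (apex N) m ∘ v = inc (apex N) l ->
    c m ∘ (i m ∘ u ∘ p l + j m ∘ v ∘ q l) = c l.
  have [mi nj mj ni _] := BP m => uE vE.
  rewrite /c compDm !compmD -!compmA.
  rewrite !(compmA (p m)) !(compmA (q m)) mi nj mj ni !comp0m !compm0 !comp1m addm0 add0m.
  by rewrite (compmA (inc _ _)) uE (compmA (inc _ _)) vE.
have cm l m : (l <= m)%O -> exists u, c m ∘ u = c l.
  by move=> lm; eexists; apply: (step _ _ (gtr M lm) (gtr N lm)); apply: inc_tr.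
have cz l : (forall b, b \in bs ++ bs' -> (l < b)%O) -> is_zero_obj (S l).
  move=> lb; apply/zero_objP; have [_ _ _ _ <-] := BP l.
  have /zero_objP zM : is_zero_obj (gr M l).
    by apply: (proj1 bP) => b bb; apply: lb; rewrite mem_cat bb.
  have /zero_objP zN : is_zero_obj (gr N l).
    by apply: (proj1 bP') => b bb; apply: lb; rewrite mem_cat bb orbT.
  by rewrite -[p l]comp1m -[q l]comp1m zM zN !comp0m !compm0 addm0.
have cc l m : (l <= m)%O -> (forall b, b \in bs ++ bs' -> ~ (l < b <= m)%O) ->
    exists u, c l ∘ u = c m.
  move=> lm no.
  have [|x [_ xE]] := proj2 bP l m lm.
    by move=> b bb; apply: no; rewrite mem_cat bb.
  have [|y [_ yE]] := proj2 bP' l m lm.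
    by move=> b bb; apply: no; rewrite mem_cat bb orbT.
  eexists; apply: (step _ _ x y); rewrite -(inc_tr _ lm) -compmA.
    by rewrite xE compm1.
  by rewrite yE compm1.
have cf l : (forall b, b \in bs ++ bs' -> (b <= l)%O) -> exists u, c l ∘ u = idm V.
  move=> lb.
  have [|x [_ xE]] := inc_iso (apex M) bP (l := l).
    by move=> b bb; apply: lb; rewrite mem_cat bb.
  have [|y [_ yE]] := inc_iso (apex N) bP' (l := l).
    by move=> b bb; apply: lb; rewrite mem_cat bb orbT.
  exists (i l ∘ x ∘ pV + j l ∘ y ∘ qV); rewrite -bVE.
  have [mi nj mj ni _] := BP l.
  rewrite /c compDm !compmD -!compmA.
  rewrite !(compmA (p l)) !(compmA (q l)) mi nj mj ni !comp0m !compm0 !comp1m addm0 add0m.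
  by rewrite (compmA (inc _ _)) xE (compmA (inc _ _)) yE !comp1m.
pose B0 := fam_obj ck cm cz cc cf.
pose sB : summit B0 := @Summit B0 V c (fam_vertex ck cm cf).
have [i' iE] : exists f : hom M B0, tmap (apex M) sB f = iV.
  apply: tmap_ex_lift => l; exists (i l); have [mi nj mj ni _] := BP l.
  by rewrite /= /c compDm -!compmA mi ni !compm1 !compm0 addm0.
have [j' jE] : exists f : hom N B0, tmap (apex N) sB f = jV.
  apply: tmap_ex_lift => l; exists (j l); have [mi nj mj ni _] := BP l.
  by rewrite /= /c compDm -!compmA mj nj !compm1 !compm0 add0m.
have [p' pE] : exists f : hom B0 M, tmap sB (apex M) f = pV.
  apply: tmap_ex_lift => l; exists (p l).
  by rewrite /= /c compmD !compmA pi pj !comp0m comp1m addm0.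
have [q' qE] : exists f : hom B0 N, tmap sB (apex N) f = qV.
  apply: tmap_ex_lift => l; exists (q l).
  by rewrite /= /c compmD !compmA qi qj !comp0m comp1m add0m.
exists B0, i', j', p', q'; split.
- by apply: (@tmap_inj _ _ (apex M) (apex M)); rewrite (tmap_comp _ sB) iE pE tmap_idm.
- by apply: (@tmap_inj _ _ (apex N) (apex N)); rewrite (tmap_comp _ sB) jE qE tmap_idm.
- by apply: (@tmap_inj _ _ (apex N) (apex M)); rewrite (tmap_comp _ sB) jE pE tmap_zero.
- by apply: (@tmap_inj _ _ (apex M) (apex N)); rewrite (tmap_comp _ sB) iE qE tmap_zero.
apply: (@tmap_inj _ _ sB sB).
by rewrite tmap_add (tmap_comp _ (apex M)) (tmap_comp _ (apex N)) iE jE pE qE tmap_idm.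
Qed.

(** * Kernels and cokernels in [Wpre] *)

Let kernelWP := @Additive.kernelP W addW bilW zeroW_ex.
Let cokernelWP := @Additive.cokernelP W addW bilW zeroW_ex.

Lemma cmp_iso (M N : W) (f : hom M N) l : is_iso f -> is_iso (cmp f l).
Proof.
by case=> g [gf fg]; exists (cmp g l); rewrite -!cmp_comp gf fg !cmp_idm.
Qed.

Lemma tmap_iso (M N : W) (s : summit M) (t : summit N) (f : hom M N) :
  is_iso f -> is_iso (tmap s t f).
Proof.
by case=> g [gf fg]; exists (tmap t s g); rewrite -!tmap_comp gf fg !tmap_idm.
Qed.

Lemma kernelW_of_pointwise (M N K : W) (f : hom M N) (k : hom K M) :
  (forall l, is_kernel (cmp f l) (cmp k l)) -> is_kernel f k.
Proof.
move=> kl; have mk l : monic (cmp k l) by have /kernelP[] := kl l.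
apply/kernelWP; split.
- by apply: cmp_inj => l; rewrite cmp_comp; have /kernelP[-> _ _] := kl l.
- by move=> T u v uv; apply: cmp_inj => l; apply: (mk l); rewrite -!cmp_comp uv.
move=> T t ft.
have lift l : exists h, cmp k l ∘ h = cmp t l.
  by have /kernelP[_ _ kE] := kl l; apply: kE; rewrite -cmp_comp ft.
pose h l := sval (cid (lift l)).
have hE l : cmp k l ∘ h l = cmp t l by apply: (svalP (cid (lift l))).
have [|g gE] := @mor_ex T K h.
  move=> l m lm; apply: (mk m).
  by rewrite !compmA hE !cmp_tr -compmA hE.
by exists g; apply: cmp_inj => l; rewrite cmp_comp gE hE.
Qed.

(** The levelwise kernels are included by [c l] in the kernel [kappa] of the underlying map.
    Followed by [kappa], [c l] is the composite of the kernels [k l] and [inc s l], so [c l] is a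
    kernel by cancellation. The breaks of [M] suffice, because transitions of [N] are monic. *)
Lemma kernelW_ex (M N : W) (f : hom M N) :
  exists K (k : hom K M), forall l, is_kernel (cmp f l) (cmp k l).
Proof.
pose s := apex M; pose t := apex N; pose phi := tmap s t f.
have [V [kappa kk]] := ker_ex phi; have [phik mk kE] := (kernelP _ _).1 kk.
pose S l := sval (cid (ker_ex (cmp f l))).
pose k l : hom (S l) (gr M l) := sval (cid (svalP (cid (ker_ex (cmp f l))))).
have kP l : is_kernel (cmp f l) (k l) by apply: (svalP (cid (svalP (cid (ker_ex (cmp f l)))))).
have lift l : exists u, kappa ∘ u = inc s l ∘ k l.
  apply: kE; rewrite compmA tmapE -compmA.
  by have /kernelP[-> _ _] := kP l; rewrite compm0.
pose c l := sval (cid (lift l)).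
have cE l : kappa ∘ c l = inc s l ∘ k l by apply: (svalP (cid (lift l))).
have ck l : kernel_mor (c l).
  apply: (kernel_mor_cancel (g := kappa)); rewrite cE; apply: kernel_mor_comp.
    by exists (gr N l), (cmp f l).
  exact: inc_kernel.
have cm l m : (l <= m)%O -> exists u, c m ∘ u = c l.
  move=> lm; have /kernelP[fk _ _] := kP l.
  have /kernelP[_ _ kmE] := kP m.
  have [|u ku] := kmE _ (gtr M lm ∘ k l).
    by rewrite compmA cmp_tr -compmA fk compm0.
  by exists u; apply: mk; rewrite compmA !cE -compmA ku compmA inc_tr.
have [bs bP] := broken_ex M.
have cz l : (forall b, b \in bs -> (l < b)%O) -> is_zero_obj (S l).
  move=> /(proj1 bP) /zero_objP z; apply/zero_objP.
  have /kernelP[_ mkl _] := kP l; apply: mkl.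
  by rewrite compm1 compm0 -[k l]comp1m (_ : idm _ = 0) // comp0m.
have cc l m : (l <= m)%O -> (forall b, b \in bs -> ~ (l < b <= m)%O) ->
    exists u, c l ∘ u = c m.
  move=> lm /(gtr_iso lm bP) [x [xt tx]]; have /kernelP[_ _ klE] := kP l.
  have /kernelP[fk _ _] := kP m.
  have [|u ku] := klE _ (x ∘ k m).
    apply: (gtr_monic (apex N) (lm := lm)).
    by rewrite !compmA -cmp_tr -(compmA (cmp f m)) tx compm1 fk compm0.
  exists u; apply: mk; rewrite compmA !cE -compmA ku compmA -(inc_tr s lm) -(compmA (inc s m)).
  by rewrite tx compm1.
have cf l : (forall b, b \in bs -> (b <= l)%O) -> exists u, c l ∘ u = idm V.
  move=> /(inc_iso s bP) [x [xi ix]]; have /kernelP[_ _ klE] := kP l.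
  have [|u ku] := klE _ (x ∘ kappa).
    apply: (@inc_monic _ t).
    by rewrite !compmA -(tmapE s) -(compmA (tmap _ _ _)) ix compm1 phik compm0.
  by exists u; apply: mk; rewrite compmA cE -compmA ku compmA ix comp1m compm1.
pose K := fam_obj ck cm cz cc cf.
have [|k' kE'] := @mor_ex K M k; last by exists K, k' => l; rewrite kE'; apply: kP.
move=> l m lm; apply: (@inc_monic _ s).
by rewrite !compmA inc_tr -!cE -compmA (_ : c m ∘ _ = c l) //; apply: fam_trE.
Qed.

Lemma kernelW_pointwise (M N K : W) (f : hom M N) (k : hom K M) l :
  is_kernel f k -> is_kernel (cmp f l) (cmp k l).
Proof.
have [K' [k' kP]] := kernelW_ex f => kk.
have [u ui <-] := kernel_iso bilW zeroW_ex (kernelW_of_pointwise kP) kk.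
by rewrite cmp_comp; apply: (kernel_comp_iso bil) => //; apply: cmp_iso.
Qed.

(** At an index where the inclusion into the top is an isomorphism, the levelwise kernel property is
    that of the underlying map. *)
Lemma kernelW_top (M N K : W) (r : summit K) (s : summit M) (t : summit N)
    (f : hom M N) (k : hom K M) :
  is_kernel f k -> is_kernel (tmap s t f) (tmap r s k).
Proof.
move=> kk; have kl l := kernelW_pointwise l kk.
apply/kernelP; split.
- by rewrite -tmap_comp; have /kernelWP[-> _ _] := kk; rewrite tmap_zero.
- move=> T u v; have [h [x [xi ix]]] := inc_iso_ex r.
  rewrite -[u]comp1m -[v]comp1m -ix -!(compmA (inc r h)) !(compmA _ (inc r h)) tmapE.
  rewrite -!(compmA (inc s h)) => /(@inc_monic _ s h) e; congr (_ ∘ _).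
  by have /kernelP[_ mk _] := kl h; apply: mk.
move=> T u e; have [h [x [xi ix]]] := inc_iso_ex s.
have /kernelP[_ _ kE] := kl h; have [|v kv] := kE _ (x ∘ u).
  apply: (@inc_monic _ t).
  by rewrite !compmA -(tmapE s) -(compmA _ _ x) ix compm1 e compm0.
by exists (inc r h ∘ v); rewrite compmA tmapE -compmA kv compmA ix comp1m.
Qed.

(* Each [W_l Q] is the strict image of [W_l N] in [Q]. *)
Definition covering (N Q : W) (r : summit Q) (q : hom N Q) : Prop :=
  forall l T (u : hom (top r) T), u ∘ inc r l ∘ cmp q l = 0 -> u ∘ inc r l = 0.

(** The induced map [v] of tops respects the filtrations: [inc o l] is the kernel of some [rho], and
    [rho ∘ v] vanishes on the image of W_l N, hence on W_l Q by covering. *)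
Lemma cokernelW_of_top (M N Q : W) (s : summit M) (t : summit N) (r : summit Q)
    (f : hom M N) (q : hom N Q) :
  is_cokernel (tmap s t f) (tmap t r q) -> covering r q -> is_cokernel f q.
Proof.
move=> /cokernelP[qf eq qE] cov; apply/cokernelWP; split.
- by apply: (@tmap_inj _ _ s r); rewrite (tmap_comp _ t) qf tmap_zero.
- move=> T u v uv; apply: (@tmap_inj _ _ r (apex T)); apply: eq.
  by rewrite -!tmap_comp uv.
move=> T u uf; pose o := apex T.
have [|v vq] := qE _ (tmap t o u); first by rewrite -tmap_comp uf tmap_zero.
have [l|g gE] := @tmap_ex_lift _ _ r o v; last first.
  by exists g; apply: (@tmap_inj _ _ t o); rewrite (tmap_comp _ r) gE.
have [Y [rho /kernelP[ri _ rE]]] := inc_kernel o l.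
apply: rE; rewrite compmA; apply: cov.
by rewrite -!compmA -(tmapE t) (compmA v) vq tmapE compmA ri comp0m.
Qed.

Lemma cokernelW_ex (M N : W) (s : summit M) (t : summit N) (f : hom M N) :
  exists Q (q : hom N Q) (r : summit Q),
    is_cokernel (tmap s t f) (tmap t r q) /\ covering r q.
Proof.
have [V [q cq]] := coker_ex (tmap s t f); have [qf eq qE] := (cokernelP _ _).1 cq.
(* [rho l] is the cokernel of W_l N -> V, and its kernel [c l] below is the strict image. *)
pose R l := sval (cid (coker_ex (q ∘ inc t l))).
pose rho l : hom V (R l) := sval (cid (svalP (cid (coker_ex (q ∘ inc t l))))).
have rP l : is_cokernel (q ∘ inc t l) (rho l).
  by apply: (svalP (cid (svalP (cid (coker_ex (q ∘ inc t l)))))).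
pose S l := sval (cid (ker_ex (rho l))).
pose c l : hom (S l) V := sval (cid (svalP (cid (ker_ex (rho l))))).
have cP l : is_kernel (rho l) (c l) by apply: (svalP (cid (svalP (cid (ker_ex (rho l)))))).
have ck l : kernel_mor (c l) by exists (R l), (rho l).
have cm l m : (l <= m)%O -> exists u, c m ∘ u = c l.
  move=> lm; have /kernelP[_ _] := cP m; apply.
  have /cokernelP[rq _ _] := rP m; have /cokernelP[_ _ /(_ _ (rho m)) [|x <-]] := rP l.
    by rewrite -(inc_tr t lm) !compmA -(compmA (rho m)) rq comp0m.
  by rewrite -compmA; have /kernelP[-> _ _] := cP l; rewrite compm0.
have [bs bP] := broken_ex N.
have cz l : (forall b, b \in bs -> (l < b)%O) -> is_zero_obj (S l).
  move=> /(proj1 bP) /zero_objP z; apply/zero_objP.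
  have /kernelP[rc mc _] := cP l; apply: mc; rewrite compm1 compm0.
  have /cokernelP[_ _ /(_ _ (idm V)) [|x xr]] := rP l.
    by rewrite comp1m -[inc t l]compm1 (_ : idm _ = 0) // !compm0.
  by rewrite -[c l]comp1m -xr -compmA rc compm0.
have cc l m : (l <= m)%O -> (forall b, b \in bs -> ~ (l < b <= m)%O) ->
    exists u, c l ∘ u = c m.
  move=> lm /(gtr_iso lm bP) [x [xt tx]]; have /kernelP[_ _] := cP l; apply.
  have /cokernelP[rq _ _] := rP l; have /cokernelP[_ _ /(_ _ (rho l)) [|y <-]] := rP m.
    rewrite -[inc t m]compm1 -tx (compmA (inc t m)) (inc_tr t lm).
    by rewrite !compmA -(compmA (rho l)) rq comp0m.
  by rewrite -compmA; have /kernelP[-> _ _] := cP m; rewrite compm0.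
have cf l : (forall b, b \in bs -> (b <= l)%O) -> exists u, c l ∘ u = idm V.
  (* Here [q ∘ inc t l] is epic, so its cokernel [rho l] is zero and the strict image is all of
     [V]. *)
  move=> /(inc_iso t bP) it; have /kernelP[_ _] := cP l; apply; rewrite compm1.
  have /cokernelP[rq _ _] := rP l; apply: eq; apply: (iso_epic it).
  by rewrite -compmA rq !comp0m.
pose Q := fam_obj ck cm cz cc cf.
pose sQ : summit Q := @Summit Q V c (fam_vertex ck cm cf).
have lift l : exists u, inc sQ l ∘ u = q ∘ inc t l.
  by have /kernelP[_ _] := cP l; apply; have /cokernelP[-> _ _] := rP l.
have [q' qE'] := tmap_ex_lift lift.
exists Q, q', sQ; rewrite qE'; split=> // l T u.
rewrite -compmA -(tmapE t) qE' => uq; have /cokernelP[_ _ /(_ _ u uq) [x <-]] := rP l.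
by rewrite -compmA; have /kernelP[-> _ _] := cP l; rewrite compm0.
Qed.

(** Any cokernel is isomorphic to the constructed one, and both properties are invariant under
    isomorphism. *)
Lemma cokernelW_top (M N Q : W) (s : summit M) (t : summit N) (r : summit Q)
    (f : hom M N) (q : hom N Q) :
  is_cokernel f q -> is_cokernel (tmap s t f) (tmap t r q) /\ covering r q.
Proof.
have [Q' [q' [r' [cq cov]]]] := cokernelW_ex s t f => qc.
have [u ui <-] := cokernel_iso bilW zeroW_ex (cokernelW_of_top cq cov) qc.
split=> [|l T v].
  rewrite (tmap_comp _ r'); apply: (cokernel_comp_iso bil zero_ex) => //.
  exact: tmap_iso.
rewrite cmp_comp compmA -(compmA v) -(tmapE r') compmA => /cov e.
by apply: (iso_epic (cmp_iso l ui)); rewrite -compmA -(tmapE r') compmA e comp0m.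
Qed.

Lemma has_kernelsW : has_kernels W.
Proof.
move=> M N f; have [K [k kP]] := kernelW_ex f.
by exists K, k; apply: kernelW_of_pointwise.
Qed.

Lemma has_cokernelsW : has_cokernels W.
Proof.
move=> M N f; have [Q [q [r [cq cov]]]] := cokernelW_ex (apex M) (apex N) f.
by exists Q, q; apply: cokernelW_of_top cq cov.
Qed.

Lemma additiveW : additive_category W.
Proof. by exists addW; split; [exact: bilW|exact: zeroW_ex|exact: bipW_ex]. Qed.

Lemma tmap_biproduct (M N S : W) (i : hom M S) (j : hom N S) (p : hom S M) (q : hom S N)
    (a : summit M) (b : summit N) (s : summit S) :
  is_biproduct addW i j p q ->
  is_biproduct add (tmap a s i) (tmap b s j) (tmap s a p) (tmap s b q).
Proof.
case=> pi qj pj qi e; split; rewrite -?tmap_comp ?pi ?qj ?pj ?qi ?tmap_idm ?tmap_zero //.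
by rewrite -tmap_add e tmap_idm.
Qed.

(** * Stability in [Wpre] from the modular law *)

Let modular := modular_kernels add.

(** On tops [q] is a kernel by stability in the base category. In degree [l] it remains to see that
    an arrow [w] into [Y] lies in W_l Y once [q] sends it into W_l P. This is the modular law in [S]
    for [Z] embedded by [mu], the kernel of [f' ∘ p1], and W_l S. *)
Lemma pushoutW_stable : modular ->
  forall (X Y Z P : W) (f : hom Z X) (g : hom Z Y) (p : hom X P) (q : hom Y P),
    is_pushout f g p q -> kernel_mor f -> kernel_mor q.
Proof.
move=> mod X Y Z P f g p q po [U [f' kf]].
have [S [i1 [i2 [p1 [p2 bS]]]]] := bipW_ex X Y.
have cS := pushout_cokernel bilW zeroW_ex bS po.
set mu := addm _ _ _ in cS; set pi := addm _ _ _ in cS.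
have [pi1 pj2 pj1 pi2 _] := bS.
have p1mu : p1 ∘ mu = f.
  by rewrite (Additive.compmD bilW) (Additive.compmN bilW) !compmA pi1 pj1 (Additive.comp0m bilW)
       (oppm0 addW) (Additive.addm0 addW) comp1m.
have p2mu : p2 ∘ mu = oppm addW g.
  by rewrite (Additive.compmD bilW) (Additive.compmN bilW) !compmA pi2 pj2 (Additive.comp0m bilW)
       (Additive.add0m addW) comp1m.
have pii2 : pi ∘ i2 = q.
  by rewrite (Additive.compDm bilW) -!compmA pj1 pj2 (Additive.compm0 bilW) compm1 (Additive.add0m addW).
pose x := apex X; pose y := apex Y; pose z := apex Z; pose s := apex S; pose r := apex P.
have [cpi cov] := cokernelW_top z s r cS.
have kf_top := kernelW_top z x (apex U) kf.
have kfm : kernel_mor (tmap z x f) by exists _, (tmap x (apex U) f').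
have mq : kernel_mor (tmap y r q).
  have bt := tmap_biproduct x y s bS.
  have : is_pushout (tmap z x f) (tmap z y g) (tmap s r pi ∘ tmap x s i1) (tmap s r pi ∘ tmap y s i2).
    apply: (cokernel_pushout bil zero_ex bt); move: cpi.
    by rewrite /mu tmap_add tmap_opp (tmap_comp _ x) (tmap_comp _ y).
  by rewrite -(tmap_comp y s r) pii2 => /pushout_stable; apply.
have [Q [k kq]] := has_cokernelsW q; exists Q, k; apply: kernelW_of_pointwise => l.
pose v := apex Q; have [ckq _] := cokernelW_top y r v kq.
have [kq0 mqt kqE] := (kernelP _ _).1 (kernel_of_cokernel bil zero_ex mq ckq).
apply/kernelP; split.
- by rewrite -cmp_comp; have /cokernelWP[-> _ _] := kq.
- apply: (monic_cancel (g := inc r l)); rewrite -(tmapE y).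
  exact: monic_comp (@inc_monic _ y l) mqt.
move=> T t kt; have [|w qw] := kqE _ (inc r l ∘ t).
  by rewrite compmA (tmapE r v) -compmA kt compm0.
have [Cc [c ccy]] := coker_ex (inc y l).
have /kernelP[ciy _ cE] := kernel_of_cokernel bil zero_ex (inc_kernel y l) ccy.
suff cw : c ∘ w = 0.
  have [w' iw'] := cE _ _ cw; exists w'; apply: (@inc_monic _ r).
  by rewrite compmA -(tmapE y) -compmA iw' qw.
(* [kap] is monic, so [c ∘ w] may be tested after it. The arrow [kap ∘ c] extends from [Y] to [S] as
   [t0], which kills [mu] because the square [po'] commutes. *)
have [E [tau [kap po']]] := pushout_ex bil zero_ex bip_ex coker_ex (tmap z x f) (c ∘ tmap z y g).
have [tf _] := po'.
have mkap := kernel_mor_monic (pushout_stable po' kfm); apply: mkap; rewrite compm0.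
have [t1 t2 t3 t4 _] := tmap_biproduct x y s bS.
pose t0 := tau ∘ tmap s x p1 + kap ∘ c ∘ tmap s y p2.
have t0i2 : t0 ∘ tmap y s i2 = kap ∘ c.
  by rewrite compDm -!compmA t3 t2 compm1 compm0 add0m.
have -> : kap ∘ (c ∘ w) = t0 ∘ (tmap y s i2 ∘ w) by rewrite [RHS]compmA t0i2 compmA.
have [f'f _ _] := (kernelP _ _).1 kf_top.
have tp1 : tmap s x p1 ∘ tmap z s mu = tmap z x f by rewrite -tmap_comp p1mu.
have tp2 : tmap s y p2 ∘ tmap z s mu = - tmap z y g by rewrite -tmap_comp p2mu tmap_opp.
have [pimu _ piE] := (cokernelP _ _).1 cpi.
apply: (mod _ _ _ _ _ (tmap z s mu) (inc s l) (tmap x (apex U) f' ∘ tmap s x p1)).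
- apply: (kernel_mor_cancel (g := tmap s x p1)).
  by rewrite tp1.
- exact: inc_kernel.
- by rewrite -compmA tp1 f'f.
- by rewrite -compmA (compmA (tmap s x p1)) t3 comp0m compm0.
(* [i2 ∘ w] lies in the sum of [mu] and W_l S: an arrow killing [mu] factors through [pi], and W_l P
   is the strict image of W_l S. *)
- move=> T' sg /piE [sg' <-]; rewrite -compmA (tmapE s r) compmA => /cov e.
  by rewrite -compmA (compmA (tmap s r pi)) -tmap_comp pii2 qw compmA e comp0m.
- by rewrite compDm -!compmA tp1 tp2 tf !compmN addmN.
(* The first component lies in W_l X and is killed by [f'], hence comes from W_l Z, kernels being
   levelwise. Then [tau ∘ f] becomes [kap ∘ c ∘ g], and [c] kills W_l Y. *)
move=> V u; rewrite -(compmA _ _ (inc s l)) (tmapE s x) compmA (tmapE x) -!compmA => e.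
have /kernelP[_ _ fE] := kernelW_pointwise l kf.
have [|u' fu'] := fE _ (cmp p1 l ∘ u); first by apply: (@inc_monic _ (apex U)); rewrite compm0.
rewrite compDm -!compmA (compmA (tmap s x p1)) (compmA (tmap s y p2)) !(tmapE s).
rewrite -!compmA -fu' (compmA (inc x l)) -(tmapE z) !compmA tf.
rewrite -(compmA kap c (inc y l)) ciy compm0 comp0m comp0m addm0.
by rewrite -!compmA (compmA _ (inc z l)) tmapE -!compmA (compmA c) ciy comp0m compm0.
Qed.

Hypothesis pullback_stable :
  forall (X Y Z P : A) (f : hom X Z) (g : hom Y Z) (p : hom P X) (q : hom P Y),
    is_pullback f g p q -> cokernel_mor f -> cokernel_mor q.

(** On tops [q] is a cokernel by stability in the base category; it remains to see that W_l Y is the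
    strict image of W_l P. This is the modular law in [S] for the kernel of [f] embedded by [i1],
    [P] as the kernel of [beta], and W_l S. *)
Lemma pullbackW_stable : modular ->
  forall (X Y Z P : W) (f : hom X Z) (g : hom Y Z) (p : hom P X) (q : hom P Y),
    is_pullback f g p q -> cokernel_mor f -> cokernel_mor q.
Proof.
move=> mod X Y Z P f g p q pb [U [f' cf]].
have [S [i1 [i2 [p1 [p2 bS]]]]] := bipW_ex X Y.
have kS := pullback_kernel bilW zeroW_ex bS pb.
set beta := addm _ _ _ in kS; set k := addm _ _ _ in kS.
have [pi1 pj2 pj1 pi2 _] := bS.
have p1k : p1 ∘ k = p.
  by rewrite (Additive.compmD bilW) !compmA pi1 pj1 (Additive.comp0m bilW) (Additive.addm0 addW) comp1m.
have p2k : p2 ∘ k = q.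
  by rewrite (Additive.compmD bilW) !compmA pi2 pj2 (Additive.comp0m bilW) (Additive.add0m addW) comp1m.
have betai1 : beta ∘ i1 = f.
  rewrite (Additive.compDm bilW) (Additive.compNm bilW) -!compmA pi1 pi2.
  by rewrite (Additive.compm0 bilW) (oppm0 addW) (Additive.addm0 addW) compm1.
pose x := apex X; pose y := apex Y; pose z := apex Z; pose s := apex S; pose r := apex P.
have kk := kernelW_top r s z kS.
have [bk mk kE] := (kernelP _ _).1 kk.
have [ctf covf] := cokernelW_top (apex U) x z cf.
have cfm : cokernel_mor (tmap x z f) by exists _, (tmap (apex U) x f').
have cq : cokernel_mor (tmap r y q).
  have bt := tmap_biproduct x y s bS.
  have : is_pullback (tmap x z f) (tmap y z g) (tmap s x p1 ∘ tmap r s k) (tmap s y p2 ∘ tmap r s k).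
    apply: (kernel_pullback bil zero_ex bt); move: kk.
    by rewrite /beta tmap_add tmap_opp (tmap_comp _ x) (tmap_comp _ y).
  by rewrite -(tmap_comp r s y) p2k => /pullback_stable; apply.
have [K [ka kka]] := has_kernelsW q.
exists K, ka; apply: (@cokernelW_of_top _ _ _ (apex K) r y).
  by apply: (cokernel_of_kernel bil zero_ex) => //; apply: kernelW_top.
move=> l T sg sgq.
(* [eta] is epic by stability, so W_l Y may be replaced by its preimage in [P]. *)
have [D [om [eta pbD]]] := pullback_ex bil zero_ex bip_ex ker_ex (tmap r y q) (inc y l).
have [qom _] := pbD.
have eeta := cokernel_mor_epic (pullback_stable pbD cq).
apply: eeta; rewrite comp0m -compmA -qom.
have [t1 t2 t3 t4 _] := tmap_biproduct x y s bS.
have [B [b kb]] := ker_ex (tmap x z f); have [fb mb bE] := (kernelP _ _).1 kb.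
have [_ _ fE] := (cokernelP _ _).1 (cokernel_of_kernel bil zero_ex cfm kb).
have -> : sg ∘ (tmap r y q ∘ om) = sg ∘ tmap s y p2 ∘ (tmap r s k ∘ om).
  by rewrite -p2k (tmap_comp _ s) !compmA.
apply: (mod _ _ _ _ _ (tmap x s i1 ∘ b) (inc s l) (tmap s z beta)).
- apply: kernel_mor_comp; first by exists _, (tmap x z f).
  exists _, (tmap s y p2).
  exact: (biproduct_inl_kernel bil zero_ex (tmap_biproduct x y s bS)).
- exact: inc_kernel.
- by rewrite compmA -tmap_comp betai1 fb.
- by rewrite compmA bk comp0m.
(* The preimage lies in the sum of the kernel of [f] and W_l S: [f] sends its first component into
   W_l Z, which W_l X covers, and its second component lies in W_l Y. *)
- move=> T' s' s'b s'inc.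
  have [|sg' sg'f] := fE _ (s' ∘ tmap x s i1); first by rewrite -compmA.
  rewrite [tmap r s k ∘ om](biproduct_hom_in bil (tmap_biproduct x y s bS)).
  rewrite compmD !(compmA _ (tmap r s k)) -!tmap_comp p1k p2k.
  rewrite (compmA s') -sg'f -compmA (compmA (tmap x z f)) -tmap_comp.
  have [fp _] := pb; rewrite fp (tmap_comp r y z) -compmA qom !compmA.
  rewrite -!(compmA _ _ (inc y l)) (tmapE y z) (compmA sg').
  have -> : sg' ∘ inc z l = 0.
    apply: covf; rewrite -compmA -(tmapE x) compmA sg'f -compmA (tmapE x).
    by rewrite compmA s'inc comp0m.
  by rewrite !comp0m add0m (tmapE y) compmA s'inc !comp0m.
- by rewrite -compmA (compmA (tmap s y p2)) t4 comp0m compm0.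
(* Kernels being levelwise, the part of W_l S killed by [beta] is W_l P, where [sg] after [q]
   vanishes. *)
move=> V u; rewrite (tmapE s) -compmA => e.
have /kernelP[_ _ klE] := kernelW_pointwise l kS.
have [|u' ku'] := klE _ u; first by apply: (@inc_monic _ z); rewrite compm0.
rewrite -ku' -(compmA sg) (tmapE s) !compmA -(compmA _ (cmp p2 l)) -cmp_comp p2k.
by rewrite sgq comp0m.
Qed.

(** * The modular law from stability in [Wpre] *)

Lemma zero_obj_kernel_mor (Z X : A) : is_zero_obj Z -> kernel_mor (0 : hom Z X).
Proof.
move=> /zero_objP Z0; exists X, (idm X); apply/kernelP; split; first exact: compm0.
  by move=> T u v _; rewrite -[u]comp1m -[v]comp1m Z0 !comp0m.
by move=> T t; rewrite comp1m => ->; exists 0; rewrite compm0.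
Qed.

(** The filtration is zero before [a], then [D], then [X] from [b] on. Neither [a] nor [b] has to be
    a genuine break: an isomorphism [f] gives a single jump at [a]. *)
Lemma step_ex (X D : A) (f : hom D X) (a b : L) : kernel_mor f -> (a < b)%O ->
  exists (M : W) (c : forall l, hom (gr M l) X),
  [/\ vertex (F := sval M) c, forall l, (l < a)%O -> is_zero_obj (gr M l),
      forall l, (b <= l)%O -> is_iso (c l)
    & exists2 e : hom D (gr M a), is_iso e & c a ∘ e = f].
Proof.
move=> kf ab; have [Z Z0] := zero_ex.
(* Object and inclusion are kept in one pair, so that rewriting [F l] changes both together. *)
pose sub := {S : A & hom S X}; pose mk S (g : hom S X) : sub := Tagged (fun S => hom S X) g.
pose F (l : L) : sub :=
  if (l < a)%O then mk Z 0 else if (l < b)%O then mk D f else mk X (idm X).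
pose le (x y : sub) := exists u, tagged y ∘ u = tagged x.
have F0 l : (l < a)%O -> F l = mk Z 0 by rewrite /F => ->.
have F1 l : (a <= l)%O -> (l < b)%O -> F l = mk D f.
  by rewrite /F => al ->; rewrite le_gtF.
have F2 l : (b <= l)%O -> F l = mk X (idm X).
  by rewrite /F => bl; rewrite !le_gtF // (le_trans (ltW ab)).
have ler x : le x x by exists (idm _); rewrite compm1.
pose S l := tag (F l); pose c l : hom (S l) X := tagged (F l).
have ck l : kernel_mor (c l).
  rewrite /c /S; case: (le_or_lt a l) => al; last by rewrite F0 //; apply: zero_obj_kernel_mor.
  case: (le_or_lt b l) => bl; last by rewrite F1.
  by rewrite F2 //; apply/iso_kernel_mor/iso_idm.
have cm l m : (l <= m)%O -> le (F l) (F m).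
  move=> lm; case: (le_or_lt a l) => al; last by rewrite (F0 l) //; exists 0; apply: compm0.
  case: (le_or_lt b m) => bm; first by rewrite (F2 m) //; eexists; apply: comp1m.
  by rewrite (F1 m) ?(F1 l) ?(le_trans al) ?(le_lt_trans lm).
have cz l : (forall x, x \in [:: a; b] -> (l < x)%O) -> is_zero_obj (S l).
  by move=> la; rewrite /S F0 // la // mem_head.
have cc l m : (l <= m)%O -> (forall x, x \in [:: a; b] -> ~ (l < x <= m)%O) ->
    le (F m) (F l).
  move=> lm no; case: (le_or_lt b l) => bl.
    by rewrite !F2 // (le_trans bl).
  have mb : (m < b)%O.
    case: (le_or_lt b m) => // bm; case: (no b); first by rewrite !inE eqxx orbT.
    by rewrite bl.
  case: (le_or_lt a l) => al; first by rewrite !F1 // (le_trans al).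
  have ma : (m < a)%O.
    case: (le_or_lt a m) => // am; case: (no a); first by rewrite mem_head.
    by rewrite al.
  by rewrite !F0.
have cf l : (forall x, x \in [:: a; b] -> (x <= l)%O) -> exists u, c l ∘ u = idm X.
  move=> xl; have bl : (b <= l)%O by apply: xl; rewrite !inE eqxx orbT.
  by rewrite /c /S F2 //; exists (idm X); apply: compm1.
exists (fam_obj ck cm cz cc cf), c; split.
- exact: fam_vertex ck cm cf.
- by move=> l la; rewrite /gr /= /S F0.
- move=> l bl; have : is_iso (tagged (F l)) by rewrite F2 //; apply: iso_idm.
  by [].
have : exists2 e : hom D (tag (F a)), is_iso e & tagged (F a) ∘ e = f.
  by rewrite F1 //; exists (idm D); [apply: iso_idm|apply: compm1].
by [].
Qed.

Lemma tmap_ex_lift_trivial (M N : W) (s : summit M) (t : summit N) (g : hom (top s) (top t)) :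
  (forall l, is_zero_obj (gr M l) \/ is_iso (inc t l)) -> exists f, tmap s t f = g.
Proof.
move=> H; apply: tmap_ex_lift => l; case: (H l) => [/zero_objP z|[x [xi ix]]].
  by exists 0; rewrite compm0 -[inc s l]compm1 z !compm0.
by exists (x ∘ (g ∘ inc s l)); rewrite compmA ix comp1m.
Qed.

(** With B the kernel of [beta], [f] is X -> X/K, [g] the inclusion of B/K, and [P] is B with the
    induced filtration. At [l0] the quotient X/K carries (K + D)/K and [P] carries B ∩ D, so
    covering for [q] at [l0] is the modular law. *)
Lemma modular_of_pullbackW_stable :
  (forall (X Y Z P : W) (f : hom X Z) (g : hom Y Z) (p : hom P X) (q : hom P Y),
     is_pullback f g p q -> cokernel_mor f -> cokernel_mor q) -> modular.
Proof.
move=> stab X K D Y0 W0 a d' beta w ka kd ba bw aw T t ta td.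
have [l1 l01] := L_nomax l0; have [l2 l12] := L_nomax l1.
(* The steps are placed so that [a] and [beta] respect them: [MK] is zero until [l1], where [MX] is
   all of [X], and [MY] is all of [Y0] from [l0], where [MX] starts. *)
have [MX [cX [vX zX iX [e [e' [e'e ee']] eE]]]] := step_ex kd l01.
have [MK [cK [vK zK _ _]]] := step_ex (iso_kernel_mor (iso_idm K)) l12.
have [MY [cY [vY _ _ [u ui uE]]]] := step_ex (iso_kernel_mor (iso_idm Y0)) l01.
pose sX : summit MX := Summit vX; pose sK : summit MK := Summit vK; pose sY : summit MY := Summit vY.
have cY0 : is_iso (inc sY l0).
  exact: monic_section (@inc_monic _ sY l0) uE.
have [f0 f0E] : exists f0, tmap sK sX f0 = a.
  apply: tmap_ex_lift_trivial => l; case: (le_or_lt l1 l) => ll; first by right; apply: iX.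
  by left; apply: zK.
have [f1 f1E] : exists f1, tmap sX sY f1 = beta.
  apply: tmap_ex_lift_trivial => l; case: (le_or_lt l0 l) => ll; last by left; apply: zX.
  by right; apply: inc_iso_le cY0.
have f10 : f1 ∘ f0 = zerom addW _ _.
  by apply: (@tmap_inj _ _ sK sY); rewrite (tmap_comp _ sX) f0E f1E tmap_zero.
have [Z [f cf]] := has_cokernelsW f0; have [_ _ /(_ _ f1 f10) [bb bbf]] := (cokernelWP _ _).1 cf.
pose z := apex Z; have [cft covf] := cokernelW_top sK sX z cf.
have [fa _ fE] := (cokernelP _ _).1 cft; rewrite f0E in fa fE.
have [Y [g kg]] := has_kernelsW bb; pose y := apex Y.
have [P [p [q pb]]] := Additive.pullback_ex bilW zeroW_ex bipW_ex has_kernelsW f g.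
have cf' : cokernel_mor f by exists MK, f0.
have [U [h ch]] := stab _ _ _ _ _ _ _ _ pb cf'.
have [_ cov] := cokernelW_top (apex U) (apex P) y ch.
have [fp _] := pb.
have [R [zeta /kernelP[zi _ zE]]] := inc_kernel z l0.
(* The class of [w] modulo K lies in W_l0 Z: if [inc z l0] is the kernel of [zeta], then [zeta]
   after [f] kills K and D, hence [w] by [aw]. *)
have [w0 w0E] : exists w0, inc z l0 ∘ w0 = tmap sX z f ∘ w.
  apply: zE; rewrite compmA; apply: aw; first by rewrite -compmA fa compm0.
  by rewrite -eE compmA -(compmA zeta) (tmapE sX z f l0) compmA zi !comp0m.
have /kernelP[_ _ gE] := kernelW_pointwise l0 kg.
have [|y0 y0E] := gE _ w0.
  apply: (@inc_monic _ sY l0); rewrite compmA -(tmapE z) -compmA w0E compmA -tmap_comp bbf f1E.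
  by rewrite bw compm0.
have [tb tbf] := fE _ t ta.
(* By covering it is enough to test on W_l0 P, which maps into W_l0 X = D with image killed by
   [beta]; there [td] applies. *)
have e0 : tb ∘ tmap y z g ∘ inc y l0 = 0.
  apply: cov; rewrite -!compmA (compmA _ (inc y l0)) (tmapE y z) -compmA -cmp_comp -fp cmp_comp.
  rewrite (compmA (inc z l0)) -(tmapE sX) !compmA tbf.
  have cXE : inc sX l0 = d' ∘ e' by rewrite -eE -compmA ee' compm1.
  rewrite cXE compmA -compmA; apply: td; rewrite compmA -(compmA beta) -cXE.
  rewrite -f1E (tmapE sX sY) -compmA -cmp_comp -bbf -compmA fp compmA.
  have [-> _ _] := (kernelWP _ _).1 kg.
  by rewrite (Additive.comp0m bilW) cmp_zero compm0.
rewrite -tbf -compmA -w0E -y0E (compmA (inc z l0)) -(tmapE y) !compmA e0.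
by rewrite comp0m.
Qed.

End Filtered.

(** * Density and unboundedness of a nonzero divisible ordered group *)

Section OrderedGroup.
Variable L : porderZmodType.
Hypothesis L_total : total (<=%O : rel L).
Hypothesis L_add : forall x y z : L, (x <= y -> x + z <= y + z)%R.
Hypothesis L_div : forall (n : nat) (x : L), (0 < n)%N -> exists! y : L, (y *+ n = x)%R.
Hypothesis L_neq0 : exists x : L, (x != 0)%R.
Local Open Scope ring_scope.

Lemma ordered_group_ltD2r (x y z : L) : x < y -> x + z < y + z.
Proof.
rewrite !lt_def => /andP[xy /L_add ->]; rewrite andbT.
by apply: contra_neq xy => /addIr.
Qed.

Lemma ordered_group_pos : exists e : L, 0 < e.
Proof.
have [x x0] := L_neq0; case/orP: (L_total 0 x) => le0.
  by exists x; rewrite lt_def x0 le0.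
exists (- x); rewrite -(subrr x) -[ltRHS]add0r; apply: ordered_group_ltD2r.
by rewrite lt_def eq_sym x0 le0.
Qed.

Lemma ordered_group_nomin (x : L) : exists y, y < x.
Proof.
have [e e0] := ordered_group_pos; exists (- e + x); rewrite -[ltRHS]add0r.
apply: ordered_group_ltD2r; rewrite -[ltLHS]add0r -[ltRHS](subrr e).
exact: ordered_group_ltD2r.
Qed.

Lemma ordered_group_nomax (x : L) : exists y, x < y.
Proof.
have [e e0] := ordered_group_pos; exists (e + x); rewrite -[ltLHS]add0r.
exact: ordered_group_ltD2r.
Qed.

(** The witness is the midpoint, half of [x + y]; on the wrong side of [x] or [y] its double could
    not be [x + y]. *)
Lemma ordered_group_dense (x y : L) : x < y -> exists z, x < z < y.
Proof.
move=> xy; have [z [zE _]] := L_div (x + y) (isT : (0 < 2)%N); exists z.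
rewrite mulr2n in zE; apply/andP; split.
  have [zx|//] := le_or_lt L_total z x.
  have : z + z < x + y.
    apply: le_lt_trans (L_add z zx) _.
    apply: le_lt_trans (_ : x + x < x + y); last first.
      by rewrite ![x + _]addrC; apply: ordered_group_ltD2r.
    by rewrite ![x + _]addrC; apply: L_add.
  by rewrite zE ltxx.
have [yz|//] := le_or_lt L_total y z.
have : x + y < z + z.
  apply: lt_le_trans (ordered_group_ltD2r y xy) _.
  apply: le_trans (L_add y yz) _.
  by rewrite ![z + _]addrC; apply: L_add.
by rewrite zE ltxx.
Qed.

End OrderedGroup.

(** * Assembly over an ordered group, with [0] as base index *)

Local Open Scope ring_scope.

Theorem propositionA2p1 (A : category) (L : porderZmodType)
    (L_total : total (<=%O : rel L))
    (L_add : forall x y z : L, x <= y -> x + z <= y + z)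
    (L_div : forall (n : nat) (x : L), (0 < n)%N -> exists! y : L, y *+ n = x)
    (L_neq0 : exists x : L, x != 0)
    (A_qab : quasi_abelian A) :
  [/\ additive_category (Wpre A L), has_kernels (Wpre A L)
    & has_cokernels (Wpre A L)] /\
  (quasi_abelian (Wpre A L) <-> modular_law A).
Proof.
have dense := ordered_group_dense L_total L_add L_div.
have nomin := ordered_group_nomin L_total L_add L_neq0.
have nomax := ordered_group_nomax L_total L_add L_neq0.
have [[add [bil zero_ex bip_ex]] ker_ex coker_ex po_stable pb_stable] := A_qab.
have addW := additiveW bil zero_ex bip_ex ker_ex coker_ex po_stable 0 L_total dense nomin nomax.
have kerW := has_kernelsW bil zero_ex bip_ex ker_ex coker_ex po_stable 0 L_total dense nomin nomax.
have cokerW := has_cokernelsW bil zero_ex bip_ex ker_ex coker_ex po_stable 0 L_total dense nomin nomax.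
have modP := modular_lawP bil zero_ex bip_ex ker_ex coker_ex po_stable.
split=> //; split=> [[_ _ _ _ stab]|/modP mod].
  apply/modP.
  exact: (modular_of_pullbackW_stable bil zero_ex bip_ex ker_ex coker_ex po_stable 0
    L_total dense nomin nomax stab).
split=> //.
  exact: (pushoutW_stable bil zero_ex bip_ex ker_ex coker_ex po_stable 0
    L_total dense nomin nomax mod).
exact: (pullbackW_stable bil zero_ex bip_ex ker_ex coker_ex po_stable 0
  L_total dense nomin nomax pb_stable mod).
Qed.
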